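(* Let $(X,d)$ be a complete separable metric space and let $\vartheta:\mathbb{R}_+\to\mathbb{R}_+$ be a ccc function with minimal convex-concave factorization $(\varphi,\psi)$. Then $W_\vartheta$ is a complete metric on $\mathcal{P}_\vartheta(X)$.
   Context: $\mathbb{R}_+=[0,\infty)$. Throughout, $\vartheta:\mathbb{R}_+\to\mathbb{R}_+$ is strictly increasing and continuous with $\vartheta(0)=0$. $\vartheta$ is called a ccc function (convex-concave composition) iff there exist two strictly increasing continuous functions $\varphi,\psi:\mathbb{R}_+\to\mathbb{R}_+$ with $\varphi(0)=\psi(0)=0$ such that $\varphi$ is convex, $\psi$ is concave and $\vartheta=\varphi\circ\psi$. Such a pair $(\varphi,\psi)$ is called a convex-concave factorization of $\vartheta$. It is called minimal if for any other factorization $(\tilde\varphi,\tilde\psi)$ of $\vartheta$ the function $\varphi^{-1}\circ\tilde\varphi$ is convex. The $L^\vartheta$-Wasserstein space $\mathcal{P}_\vartheta(X)$ is the space of all probability measures $\mu$ on $X$ (equipped with its Borel $\sigma$-field) such that $\int_X\varphi\left(\frac1t\psi(d(x,y))\right)d\mu(x)<\infty$ for some $y\in X$ and some $t\in(0,\infty)$. The $L^\vartheta$-Wasserstein distance of $\mu,\nu\in\mathcal{P}_\vartheta(X)$ is $$W_\vartheta(\mu,\nu)=\inf\left\{t>0:\ \inf_{q\in\Pi(\mu,\nu)}\int_{X\times X}\varphi\left(\frac1t\psi(d(x,y))\right)dq(x,y)\le 1\right\},$$ where $\Pi(\mu,\nu)$ is the set of all couplings of $\mu$ and $\nu$, i.e.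 of all probability measures $q$ on $X\times X$ such that $q(A\times X)=\mu(A)$ and $q(X\times A)=\nu(A)$ for all Borel sets $A\subset X$. *)

(* Defs.v *)
From HB Require Import structures.
From mathcomp Require Import all_boot all_order all_algebra.
From mathcomp Require Import all_classical all_reals all_analysis.
From mathcomp Require Import giry.

Set Implicit Arguments.
Unset Strict Implicit.
Unset Printing Implicit Defensive.

Import Order.TTheory GRing.Theory Num.Theory.
Import numFieldNormedType.Exports.

Local Open Scope classical_set_scope.
Local Open Scope ring_scope.

(* Maps of the half-line [0, +oo[ are functions R -> R of which only the
   restriction to [0, +oo[ matters; scale functions map [0, +oo[ to itself
   because they vanish at 0 and increase. *)
Definition scale_function (R : realType) (f : R -> R) : Prop :=
  [/\ f 0 = 0,
      {in `[0, +oo[ &, {homo f : x y / x < y}} &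
      {within `[0, +oo[, continuous f}].

Definition convex_on_Rplus (R : realType) (f : R -> R) : Prop :=
  convex_function (`[0, +oo[%classic : set R) f.

Definition concave_on_Rplus (R : realType) (f : R -> R) : Prop :=
  convex_on_Rplus (fun x => - f x).

Definition ccc_factorization (R : realType) (theta phi psi : R -> R) : Prop :=
  [/\ scale_function phi, scale_function psi,
      convex_on_Rplus phi, concave_on_Rplus psi &
      {in `[0, +oo[, theta =1 phi \o psi}].

Definition ccc_function (R : realType) (theta : R -> R) : Prop :=
  scale_function theta /\
  exists phi psi : R -> R, ccc_factorization theta phi psi.

(* Convex scale functions are onto [0, +oo[, so the default value given to
   'pinv_ is never used. *)
Definition Rplus_inv (R : realType) (phi : R -> R) : R -> R :=
  'pinv_(fun=> 0) `[0, +oo[ phi.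

Definition minimal_ccc_factorization (R : realType)
    (theta phi psi : R -> R) : Prop :=
  ccc_factorization theta phi psi /\
  forall phi' psi' : R -> R, ccc_factorization theta phi' psi' ->
    convex_on_Rplus (Rplus_inv phi \o phi').

(* The pointed (nonempty) complete metric spaces. *)
#[short(type="completeMetricType")]
HB.structure Definition CompleteMetric (R : numFieldType) :=
  {T of Metric R T & CompletePseudoMetric R T}.

Definition separable (T : topologicalType) : Prop :=
  exists2 D : set T, countable D & dense D.

Notation borelType T := (g_sigma_algebraType (@open T)).

(* Couplings live on the product sigma-algebra, which for separable X is the
   Borel sigma-algebra of X * X. *)
Definition couplings (R : realType) (X : completeMetricType R)
    (mu nu : probability (borelType X) R) :
    set (probability (borelType X * borelType X)%type R) :=
  [set q | forall A : set (borelType X), measurable A ->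
     q (A `*` setT) = mu A /\ q (setT `*` A) = nu A].

Definition wasserstein_space (R : realType) (X : completeMetricType R)
    (phi psi : R -> R) : set (probability (borelType X) R) :=
  [set mu : probability (borelType X) R | exists (y : X) (t : R), 0 < t /\
     (\int[mu]_x (phi (t^-1 * psi (mdist (x : X) y)))%:E < +oo)%E].

Definition wasserstein_dist (R : realType) (X : completeMetricType R)
    (phi psi : R -> R) (mu nu : probability (borelType X) R) : \bar R :=
  ereal_inf [set t%:E | t in [set t : R | 0 < t /\
    (ereal_inf
       [set \int[q]_z (phi (t^-1 * psi (mdist (z.1 : X) (z.2 : X))))%:E
         | q in couplings mu nu] <= 1)%E]].

Arguments wasserstein_space {R} X phi psi.
Arguments wasserstein_dist {R} X phi psi mu nu.

(* A library measure is a function on all subsets, specified only on the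
   measurable ones, so equality of measures is [measure_eq] (agreement on
   measurable sets) rather than Leibniz equality. *)
Definition is_metric_on_measures (d : measure_display) (T : measurableType d)
    (R : realType) (S : set (probability T R))
    (D : probability T R -> probability T R -> \bar R) : Prop :=
  [/\ forall x y, S x -> S y -> (0 <= D x y < +oo)%E,
      forall x y, S x -> S y -> (D x y = 0%E <-> measure_eq x y),
      forall x y, S x -> S y -> D x y = D y x &
      forall x y z, S x -> S y -> S z -> (D x z <= D x y + D y z)%E].

Definition is_complete_on (R : realType) (T : Type)
    (S : set T) (D : T -> T -> \bar R) : Prop :=
  forall u : nat -> T, (forall n, S (u n)) ->
    (forall e : R, 0 < e -> \forall m & n \near \oo, (D (u m) (u n) < e%:E)%E) ->
    exists2 x, S x & D (u n) x @[n --> \oo] --> 0%E.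

(* Main.v *)
From HB Require Import structures.
From mathcomp Require Import all_boot all_order all_algebra.
From mathcomp Require Import all_classical all_reals all_analysis.
From mathcomp Require Import giry measurable_realfun ring lra.
Require Import Defs.

(** Put [rho x y := psi (mdist x y)]. Since [psi] is concave and vanishes at 0
    it is subadditive, so [rho] satisfies the triangle inequality; since [phi]
    is convex, the condition [E (phi (a / t)) <= 1] says that the Luxemburg
    norm of the nonnegative random variable [a] is at most [t], and these
    conditions add up along sums ([luxemburg_add]). Up to an arbitrarily small
    loss in [t], the distance of [mu] and [nu] is at most [t] iff some coupling
    of [mu] and [nu] gives [rho] a Luxemburg norm at most [t]; this relation is
    [coupled_within], and [wasserstein_le] and [wasserstein_lt_coupled] are the
    two halves of the equivalence. Everything is proved about [coupled_within].

    Triangle inequality. Gluing two couplings along their common marginal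
    normally asks for disintegrations. An approximate gluing suffices here: the
    space is cut into countably many cells of small diameter, and the couplings
    are made conditionally independent given the cell of the middle point
    ([discrete_gluing]). The two copies of the middle point then differ, but
    stay in one cell, and the additional cost is as small as one likes
    ([coupled_within_triangle]).

    Separation. When [t] tends to 0 the Markov inequality makes
    [mdist x y >= e] unlikely under a coupling whose norm is at most [t], so
    [mu F <= nu (thicken F e)] for all [e], hence [mu F <= nu F] for [F] closed;
    by symmetry both measures agree on closed sets, and thus on Borel sets.

    Completeness. It suffices to treat a sequence [v k] whose consecutive terms
    are coupled within [r k / 3], where [r k] tends to 0 fast ([rapid_limit]). The points of
    the space are rounded to a dense sequence, which turns [v k] into the law of
    a variable with values in [nat], and the couplings into couplings of such
    discrete laws. As Lebesgue measure on the unit interval has no atom, any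
    event can be cut into pieces of prescribed measures
    ([unit_interval_divisible]), so one can construct, one after the other, maps
    [S k] from the unit interval to [nat] such that [(S k, S k.+1)] has the
    prescribed joint law for every [k] ([chain_exists]). By Borel-Cantelli and
    the completeness of the space the corresponding points converge almost
    surely, the law of the limit is the desired limit measure, and Fatou's lemma
    bounds its distance to [v k]. This replaces tightness, compactness of sets of
    measures and infinite product constructions. *)

Set Implicit Arguments.
Unset Strict Implicit.
Unset Printing Implicit Defensive.

Import Order.TTheory GRing.Theory Num.Theory.
Import numFieldNormedType.Exports.

Local Open Scope classical_set_scope.
Local Open Scope ring_scope.

(** * Convex and concave scale functions *)

Section scale_functions.
Context {R : realType}.
Implicit Types (f phi psi : R -> R) (x y s t : R).

Lemma in_Rplus x : (x \in (`[0, +oo[ : interval R)) = (0 <= x).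
Proof. by rewrite in_itv/= andbT. Qed.

Lemma mem_Rplus x : (x \in (`[0, +oo[%classic : set R)) = (0 <= x).
Proof. by rewrite mem_setE in_Rplus. Qed.

Lemma scale_le f x y : scale_function f -> 0 <= x -> x <= y -> f x <= f y.
Proof.
move=> [_ fi _] x0; rewrite le_eqVlt => /predU1P[->//|xy].
by apply/ltW/fi; rewrite ?in_Rplus// (le_trans x0 (ltW xy)).
Qed.

Lemma scale_ge0 f x : scale_function f -> 0 <= x -> 0 <= f x.
Proof. by move=> sf x0; case: (sf) => <- _ _; apply: scale_le. Qed.

Lemma scale_gt0 f x : scale_function f -> 0 < x -> 0 < f x.
Proof.
by move=> [f0 fi _] x0; rewrite -{1}f0; apply: fi => //; rewrite in_Rplus// ltW.
Qed.

Lemma convex_on_Rplus_le f (l x y : R) : convex_on_Rplus f ->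
  0 <= l -> l <= 1 -> 0 <= x -> 0 <= y ->
  f (l * x + (1 - l) * y) <= l * f x + (1 - l) * f y.
Proof.
move=> cf l0 l1 x0 y0.
by have := cf (Itv01 l0 l1) x y; rewrite !mem_Rplus => /(_ x0 y0).
Qed.

Lemma concave_on_Rplus_le f (l x y : R) : concave_on_Rplus f ->
  0 <= l -> l <= 1 -> 0 <= x -> 0 <= y ->
  l * f x + (1 - l) * f y <= f (l * x + (1 - l) * y).
Proof.
move=> cf l0 l1 x0 y0; have := convex_on_Rplus_le cf l0 l1 x0 y0.
by rewrite !mulrN -opprD lerN2.
Qed.

(** Each of [x] and [y] is a convex combination of [x + y] and 0. *)
Lemma concave_subadditive psi x y : psi 0 = 0 -> concave_on_Rplus psi ->
  0 <= x -> 0 <= y -> psi (x + y) <= psi x + psi y.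
Proof.
move=> p0 cp x0 y0; have [s0|] := ltP 0 (x + y); last first.
  move=> h; have -> : x = 0 by lra.
  have -> : y = 0 by lra.
  by rewrite addr0 p0 addr0.
have aux a b : 0 <= a -> 0 <= b -> 0 < a + b ->
    a / (a + b) * psi (a + b) <= psi a.
  move=> a0 b0 ab0.
  have := @concave_on_Rplus_le psi (a / (a + b)) (a + b) 0 cp.
  rewrite p0 !mulr0 !addr0 divfK ?gt_eqF//; apply; rewrite ?divr_ge0 ?addr_ge0//.
  by rewrite ler_pdivrMr// mul1r lerDl.
have := lerD (aux x y x0 y0 s0) (aux y x y0 x0 _).
rewrite (addrC y x) -!mulrDl divff ?gt_eqF// mul1r; exact.
Qed.

Lemma convex_scale_le phi (l x : R) : phi 0 = 0 -> convex_on_Rplus phi ->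
  0 <= l -> l <= 1 -> 0 <= x -> phi (l * x) <= l * phi x.
Proof.
move=> p0 cp l0 l1 x0; have := convex_on_Rplus_le cp l0 l1 x0 (lexx 0).
by rewrite p0 !mulr0 !addr0.
Qed.

(** [(a + b) / (s + t)] is the convex combination of [a / s] and [b / t] with
    weights proportional to [s] and [t]. *)
Lemma convex_add_le phi (s t a b : R) : convex_on_Rplus phi ->
  0 < s -> 0 < t -> 0 <= a -> 0 <= b ->
  phi ((s + t)^-1 * (a + b)) <=
    s / (s + t) * phi (s^-1 * a) + t / (s + t) * phi (t^-1 * b).
Proof.
move=> cp s0 t0 a0 b0; have st0 : 0 < s + t by rewrite addr_gt0.
have := @convex_on_Rplus_le phi (s / (s + t)) (s^-1 * a) (t^-1 * b) cp.
have -> : 1 - s / (s + t) = t / (s + t).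
  by rewrite -[X in X - _](divff (lt0r_neq0 st0)) -mulrBl addrC addKr.
have -> : s / (s + t) * (s^-1 * a) + t / (s + t) * (t^-1 * b) =
    (s + t)^-1 * (a + b).
  by field; rewrite ?gt_eqF.
have l1 : s / (s + t) <= 1 by rewrite ler_pdivrMr// mul1r lerDl ltW.
by apply => //;
  rewrite ?mulr_ge0 ?invr_ge0 ?divr_ge0 ?(ltW s0) ?(ltW t0) ?(ltW st0).
Qed.

Lemma convex_le_lin phi x : scale_function phi -> convex_on_Rplus phi ->
  0 <= x -> x <= 1 -> phi x <= x * phi 1.
Proof.
move=> [p0 _ _] cp x0 x1; have := convex_scale_le p0 cp x0 x1 ler01.
by rewrite mulr1.
Qed.

Lemma convex_ge_lin phi x : scale_function phi -> convex_on_Rplus phi ->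
  1 <= x -> x * phi 1 <= phi x.
Proof.
move=> sp cp x1; have [p0 _ _] := sp; have x0 : 0 < x by apply: lt_le_trans x1.
have := @convex_scale_le phi x^-1 x p0 cp; rewrite mulVf ?gt_eqF// => h.
by rewrite -ler_pdivlMl//; apply: h; rewrite ?invr_ge0 ?invf_le1 ?(ltW x0).
Qed.

(** A convex scale function grows at least linearly. *)
Lemma convex_large phi (c M : R) : scale_function phi -> convex_on_Rplus phi ->
  0 < c -> exists2 s0 : R, 0 < s0 &
    forall s, 0 < s -> s <= s0 -> M <= phi (s^-1 * c).
Proof.
move=> sp cp c0; have p1 : 0 < phi 1 by apply: scale_gt0.
pose r := Num.max 1 (M / phi 1); have r0 : 0 < r by rewrite lt_max ltr01.
exists (c / r); first by rewrite divr_gt0.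
move=> s s0 ss0; have rs : r <= s^-1 * c.
  by rewrite mulrC ler_pdivlMr// mulrC -ler_pdivlMr.
apply: (@le_trans _ _ (r * phi 1)).
  by rewrite -ler_pdivrMr// le_max lexx orbT.
apply: (@le_trans _ _ (s^-1 * c * phi 1)); first by rewrite ler_pM2r.
by apply: convex_ge_lin => //; apply: le_trans rs; rewrite le_max lexx.
Qed.

Lemma scale_cvg f (u : nat -> R) (l : R) : scale_function f ->
  (forall n, 0 <= u n) -> 0 <= l -> u n @[n --> \oo] --> l ->
  f (u n) @[n --> \oo] --> f l.
Proof.
move=> [_ _ cf] u0 l0 ul.
have hf : f @ within (`[0, +oo[%classic : set R) (nbhs l) --> f l.
  have := cf l; rewrite /prop_for /continuous_at => h.
  apply: cvg_trans h; apply: cvg_app.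
  by rewrite nbhs_subspace_in//= in_itv/= l0.
have hu : u @ \oo --> within (`[0, +oo[%classic : set R) (nbhs l).
  move=> A Al.
  have h1 : \forall n \near \oo, (`[0, +oo[%classic : set R) (u n) -> A (u n).
    by have := ul _ Al; apply.
  by apply: filterS h1 => n; apply; rewrite /= in_itv/= u0.
exact: (cvg_comp u f hu hf).
Qed.

Lemma scale_small f (e : R) : scale_function f -> 0 < e ->
  exists2 d : R, 0 < d & forall x, 0 <= x -> x <= d -> f x <= e.
Proof.
move=> sf e0.
have u0 n : 0 <= (n.+1%:R : R)^-1 by rewrite invr_ge0.
have cu : f (n.+1%:R^-1) @[n --> \oo] --> f 0.
  by apply: (@scale_cvg f (fun n => n.+1%:R^-1) 0) => //; exact: cvg_harmonic.
case: (sf) => f0 _ _; rewrite f0 in cu.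
have /cvgrPdist_le/(_ e e0)[n _ /(_ n (leqnn n))/=] := cu.
rewrite sub0r normrN ger0_norm ?(scale_ge0 sf)// => fn.
exists (n.+1%:R^-1) => [|x x0 xn]; first by rewrite invr_gt0.
exact: le_trans (scale_le sf x0 xn) fn.
Qed.

Lemma cost_small phi psi (t : R) : scale_function phi -> convex_on_Rplus phi ->
  scale_function psi -> 0 < t ->
  exists2 d : R, 0 < d &
    forall x, 0 <= x -> x <= d -> phi (t^-1 * psi x) <= 1.
Proof.
move=> sphi cphi spsi t0.
pose e := Num.min 1 (phi 1)^-1; have p1 : 0 < phi 1 by apply: scale_gt0.
have e0 : 0 < e by rewrite lt_min ltr01 invr_gt0.
have [d d0 hd] := scale_small spsi (mulr_gt0 t0 e0).
exists d => // x x0 xd; have h : t^-1 * psi x <= e.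
  by rewrite mulrC ler_pdivrMr// mulrC hd.
have c0 : 0 <= t^-1 * psi x by rewrite mulr_ge0 ?(scale_ge0 spsi)// invr_ge0 ltW.
have c1 : t^-1 * psi x <= 1 by apply: le_trans h _; rewrite ge_min lexx.
apply: le_trans (convex_le_lin sphi cphi c0 c1) _.
rewrite -ler_pdivlMr// mul1r.
by apply: le_trans h _; rewrite ge_min lexx orbT.
Qed.

Lemma measurable_scale_comp d (T : measurableType d) f (g : T -> R) :
  scale_function f -> (forall w, 0 <= g w) -> measurable_fun setT g ->
  measurable_fun setT (f \o g).
Proof.
move=> [_ _ cf] g0 mg.
have mD : measurable (`[0, +oo[%classic : set R) by exact: measurable_itv.
have mf : measurable_fun (`[0, +oo[%classic : set R) f.
  exact: subspace_continuous_measurable_fun.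
apply: (measurable_comp mD _ mf mg).
by move=> _ [w _ <-]; rewrite /= in_itv/= g0.
Qed.

End scale_functions.

(** * Measurability into the integers and into separable metric spaces *)

Lemma measurable_fun_nat d (T : measurableType d) (f : T -> nat) :
  (forall n, measurable (f @^-1` [set n])) -> measurable_fun setT f.
Proof.
move=> mf _ Y _; rewrite setTI.
have -> : f @^-1` Y = \bigcup_(n in Y) f @^-1` [set n].
  by apply/seteqP; split => [x Yx|x [n Yn /= ->//]]; exists (f x).
exact: bigcup_measurable.
Qed.

Lemma measurable_preimage d d' (T : measurableType d) (T' : measurableType d')
    (f : T -> T') (B : set T') :
  measurable_fun setT f -> measurable B -> measurable (f @^-1` B).
Proof. by move=> mf mB; rewrite -[X in measurable X]setTI; exact: mf. Qed.

Lemma measurable_nat_nat (E : set (nat * nat)) : measurable E.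
Proof.
apply: countable_measurable; last exact: countableP.
move=> [i j]; rewrite (_ : [set _] = [set i] `*` [set j]).
  exact: measurableX.
by apply/seteqP; split => [z -> |[z1 z2] /= [-> ->]].
Qed.

(** The index 0 is also given to the points outside all the sets. *)
Lemma measurable_first_index d (T : measurableType d) (B : nat -> set T) :
  (forall n, measurable (B n)) -> exists f : T -> nat,
  [/\ measurable_fun setT f, forall x, (exists n, B n x) -> B (f x) x &
      forall x n, B n x -> (f x <= n)%N].
Proof.
move=> mB.
pose f x := if pselect (exists n, `[< B n x >]) is left e then ex_minn e else 0%N.
exists f; split; last 2 first.
- move=> x [n Bnx]; rewrite /f; case: pselect => [e|[]].
    by case: ex_minnP => m /asboolP.
  by exists n; apply/asboolP.
- move=> x n Bnx; rewrite /f; case: pselect => [e|//].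
  by case: ex_minnP => m _; apply; apply/asboolP.
apply: measurable_fun_nat => n.
pose N := if n == 0%N then ~` \bigcup_k B k else set0.
have -> : f @^-1` [set n] = (B n `\` \bigcup_(j in `I_n) B j) `|` N.
  apply/seteqP; split => x.
    rewrite /= /f; case: pselect => [e|ne n0].
      case: ex_minnP => m /asboolP Bm mm <-; left; split => // -[j /= jm Bjx].
      by have := mm j; rewrite leqNgt jm => /(_ (asboolT Bjx)).
    right; rewrite /N -n0 eqxx => -[k _ Bkx]; apply: ne.
    by exists k; exact: asboolT.
  move=> [[Bnx nB]|].
    rewrite /= /f; case: pselect => [e|[]]; last by exists n; exact: asboolT.
    case: ex_minnP => m /asboolP Bm mm.
    apply/eqP; rewrite eqn_leq mm ?asboolT// leqNgt; apply/negP => mn.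
    by apply: nB; exists m.
  rewrite /N; case: eqP => [->|//] nB; rewrite /= /f.
  case: pselect => [e|//]; case: ex_minnP => m /asboolP Bm _.
  by exfalso; apply: nB; exists m.
apply: measurableU.
  by apply: measurableD => //; apply: bigcup_measurable.
by rewrite /N; case: ifP => // _; apply: measurableC; exact: bigcup_measurable.
Qed.

Section real_valued.
Context d (T : measurableType d) (R : realType).
Implicit Types (f : T -> R) (r : R).

Lemma measurable_fun_sublevel f :
  (forall r, measurable [set x | f x < r]) -> measurable_fun setT f.
Proof.
move=> mf; apply: (measurability (@RGenInftyO.G R)).
  exact: RGenInftyO.measurableE.
move=> _ [_ [r ->] <-]; rewrite setTI.
have -> : f @^-1` `]-oo, r[ = [set x | f x < r].
  by apply/seteqP; split => x /=; rewrite in_itv/=.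
exact: mf.
Qed.

Lemma measurable_sublevel f r :
  measurable_fun setT f -> measurable [set x | f x < r].
Proof.
move=> mf; have := measurable_preimage mf (measurable_itv `]-oo, r[).
by rewrite (_ : _ @^-1` _ = [set x | f x < r]).
Qed.

Lemma measurable_superlevel f r :
  measurable_fun setT f -> measurable [set x | r <= f x].
Proof.
move=> mf; rewrite (_ : [set _ | _] = ~` [set x | f x < r]).
  by apply: measurableC; exact: measurable_sublevel.
by apply/seteqP; split => x /=; rewrite leNgt => /negP.
Qed.

End real_valued.

Section separable_metric.
Context {R : realType} {X : completeMetricType R}.
Implicit Types (x y : X) (a : nat -> X).

Definition dense_seq a := forall x (e : R), 0 < e -> exists k, mdist x (a k) < e.

Lemma open_mdist (U : set X) : open U <->
  forall x, U x -> exists2 e : R, 0 < e & forall y, mdist x y < e -> U y.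
Proof.
rewrite openE; split => h x Ux.
  have /nbhs_ballP[e /= e0 eU] := h x Ux; exists e => // y xy.
  by apply: eU; rewrite ballEmdist.
have [e e0 eU] := h x Ux; apply/nbhs_ballP; exists e => //= y.
by rewrite ballEmdist; exact: eU.
Qed.

Lemma open_mdist_lt x (e : R) : open [set y | mdist x y < e].
Proof.
apply/open_mdist => y /= xy; exists (e - mdist x y); first by rewrite subr_gt0.
move=> z; rewrite ltrBrDl; apply: le_lt_trans; exact: metric_triangle.
Qed.

Lemma separable_dense_seq : separable X -> exists a, dense_seq a.
Proof.
move=> [D /countable_injP[f fD] dD].
exists (fun k => xget point [set x | D x /\ f x = k]) => x e e0.
have [||y [xy Dy]] := dD [set y | mdist x y < e].
- by exists x; rewrite /= mdistxx.
- exact: open_mdist_lt.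
have Dfy : exists x, [set x | D x /\ f x = f y] x by exists y.
exists (f y); have [Dz fz] := xgetPex point Dfy.
by rewrite (fD _ _ _ _ fz)// inE.
Qed.

Lemma borel_open (U : set X) : open U -> measurable (U : set (borelType X)).
Proof. exact: sub_sigma_algebra. Qed.

Variable a : nat -> X.
Hypothesis da : dense_seq a.

(** The set [mdist x y < r] is the union of the countably many rectangles given
    by [mdist (a k) x < q] and [mdist (a k) y < r - q] with [q] rational. *)
Lemma measurable_mdist : measurable_fun setT
  (fun z : borelType X * borelType X => mdist (z.1 : X) (z.2 : X)).
Proof.
apply: measurable_fun_sublevel => r.
pose B k (q : rat) : set (borelType X * borelType X) :=
  [set y | mdist (a k) (y : X) < ratr q] `*`
  [set y | mdist (a k) (y : X) < r - ratr q].
have -> : [set z : borelType X * borelType X | mdist (z.1 : X) (z.2 : X) < r] =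
    \bigcup_k \bigcup_q B k q.
  apply/seteqP; split => [[x y] /= xyr|[x y] /= [k _ [q _ [/= xq yq]]]]; last first.
    apply: le_lt_trans (metric_triangle _ (a k) _) _.
    by rewrite metric_sym -(subrK (ratr q) r) addrC ltrD.
  pose e := (r - mdist x y) / 3; have e0 : 0 < e by rewrite divr_gt0 ?subr_gt0.
  have [k xk] := da x e0; have [q] := rat_in_itvoo xk.
  rewrite in_itv/= => /andP[xq qe]; exists k => //; exists q => //; split => /=.
    by rewrite metric_sym.
  have := metric_triangle (a k) x y; rewrite (metric_sym (a k) x).
  by move: xk qe xq; rewrite /e => h1 h2 h3 h4; lra.
apply: bigcupT_measurable => k; apply: bigcupT_measurable_rat => q.
by apply: measurableX; apply: borel_open; exact: open_mdist_lt.
Qed.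

Lemma measurable_index (e : R) : 0 < e -> exists K : borelType X -> nat,
  measurable_fun setT K /\ forall x : X, mdist x (a (K x)) < e.
Proof.
move=> e0; pose B k : set (borelType X) := [set y | mdist (a k) (y : X) < e].
have [|K [mK BK _]] := @measurable_first_index _ _ B.
  by move=> k; apply: borel_open; exact: open_mdist_lt.
exists K; split => // x; have [k xk] := da x e0.
by rewrite metric_sym; apply: BK; exists k; rewrite /B/= metric_sym.
Qed.

(** An open set is the union of the balls that it contains and that have centre
    [a k] and radius [n.+1%:R^-1]. *)
Lemma measurable_to_metric d (T : measurableType d) (f : T -> borelType X) :
  (forall k, measurable_fun setT (fun w => mdist (a k) (f w : X))) ->
  measurable_fun setT f.
Proof.
move=> mf; apply: (@measurability _ _ T (borelType X) setT f (@open X)) => //.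
move=> _ [U oU <-]; rewrite setTI.
pose B k n := [set w | (mdist (a k) (f w : X) < n.+1%:R^-1) &&
  `[< forall y : X, mdist (a k) y < n.+1%:R^-1 -> U y >] ].
have -> : f @^-1` U = \bigcup_k \bigcup_n B k n.
  apply/seteqP; split => [w /= Uw|w [k _ [n _ /= /andP[wk /asboolP]]]]; last first.
    exact.
  have /open_mdist/(_ _ Uw)[e e0 eU] := oU.
  have e20 : 0 < e / 2 by rewrite divr_gt0.
  have [n _ /(_ n (leqnn n))/= ne] := near_infty_natSinv_lt (PosNum e20).
  have n0 : 0 < n.+1%:R^-1 :> R by rewrite invr_gt0.
  have [k wk] := da (f w : X) n0.
  exists k => //; exists n => //; rewrite /B/= metric_sym wk/=.
  apply/asboolP => y ky; apply: eU.
  apply: le_lt_trans (metric_triangle _ (a k) _) _.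
  by rewrite [e]splitr ltrD//; [exact: lt_trans wk ne|exact: lt_trans ky ne].
apply: bigcupT_measurable => k; apply: bigcupT_measurable => n.
rewrite /B; case: asboolP => _; last first.
  by rewrite (_ : mkset _ = set0)//; apply/seteqP; split => w //=; rewrite andbF.
rewrite (_ : mkset _ = [set w | mdist (a k) (f w : X) < n.+1%:R^-1]).
  exact: measurable_sublevel.
by apply/seteqP; split => w //=; rewrite andbT.
Qed.

End separable_metric.

(** * Image laws and discrete decompositions *)

Lemma law_exists d d' (T : measurableType d) (T' : measurableType d')
    (R : realType) (P : probability T R) (f : T -> T') :
  measurable_fun setT f ->
  exists Q : probability T' R, forall A, Q A = P (f @^-1` A).
Proof.
move=> mf; pose F : {mfun T >-> T'} :=
  HB.pack f (isMeasurableFun.Build _ _ _ _ f mf).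
by exists (distribution P F).
Qed.

Lemma ge0_integral_law d d' (T : measurableType d) (T' : measurableType d')
    (R : realType) (P : {measure set T -> \bar R})
    (Q : {measure set T' -> \bar R}) (f : T -> T') (g : T' -> \bar R) :
  measurable_fun setT f -> (forall A, measurable A -> Q A = P (f @^-1` A)) ->
  measurable_fun setT g -> (forall y, (0 <= g y)%E) ->
  (\int[Q]_y g y = \int[P]_x g (f x))%E.
Proof.
move=> mf QP mg g0.
rewrite (eq_measure_integral (pushforward P f)); last by move=> A mA _; exact: QP.
by rewrite ge0_integral_pushforward.
Qed.

Lemma measure_nat_partition d (T : measurableType d) (R : realType)
    (m : {measure set T -> \bar R}) (f : T -> nat) (A : set T) :
  measurable_fun setT f -> measurable A ->
  m A = (\sum_(0 <= n <oo) m (A `&` f @^-1` [set n]))%E.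
Proof.
move=> mf mA.
have mAn n : measurable (A `&` f @^-1` [set n]).
  by apply: measurableI => //; exact: measurable_preimage.
rewrite -measure_semi_bigcup//; first congr (m _).
- by apply/seteqP; split => [x Ax|x [n _ []//]]; exists (f x).
- by apply/trivIsetP => i j _ _;
    apply: contra_neqP => /eqP/set0P[x [[_ <-] [_ <-]]].
- exact: bigcup_measurable.
Qed.

Section probability_of_measure.
Context d (T : measurableType d) (R : realType) (m : {measure set T -> \bar R}).
Hypothesis m1 : m setT = 1%E.

(** A name to which the structure of a probability can be attached. *)
Definition mprob_of (_ : m setT = 1%E) : set T -> \bar R := m.

HB.instance Definition _ := Measure.on (mprob_of m1).

HB.instance Definition _ := Measure_isProbability.Build _ _ _ (mprob_of m1) m1.

Lemma probability_of_measure : exists Q : probability T R, forall A, Q A = m A.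
Proof. by exists (mprob_of m1). Qed.

End probability_of_measure.

(** * Luxemburg norms *)

Section luxemburg.
Context d (T : measurableType d) (R : realType) (P : probability T R).
Variable phi : R -> R.
Hypotheses (sphi : scale_function phi) (cphi : convex_on_Rplus phi).
Implicit Types (a b c : T -> R) (s t : R).

(** For [0 < t] this says that the Luxemburg norm of [a] attached to the Young
    function [phi] is at most [t]. *)
Definition luxemburg_le t a := (\int[P]_w (phi (t^-1 * a w))%:E <= 1)%E.

Lemma measurable_phi_scaled t a : 0 < t -> (forall w, 0 <= a w) ->
  measurable_fun setT a -> measurable_fun setT (fun w => (phi (t^-1 * a w))%:E).
Proof.
move=> t0 a0 ma; apply/measurable_EFinP.
apply: (measurable_scale_comp sphi) => [w|].
  by rewrite mulr_ge0// invr_ge0 ltW.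
exact: measurable_funM.
Qed.

Lemma phi_scaled_ge0 t x : 0 < t -> 0 <= x -> (0 <= (phi (t^-1 * x))%:E)%E.
Proof.
by move=> t0 x0; rewrite lee_fin (scale_ge0 sphi)// mulr_ge0// invr_ge0 ltW.
Qed.

Lemma luxemburg_add s t a b c : 0 < s -> 0 < t ->
  (forall w, 0 <= a w) -> (forall w, 0 <= b w) -> (forall w, 0 <= c w) ->
  measurable_fun setT a -> measurable_fun setT b -> measurable_fun setT c ->
  {ae P, forall w, c w <= a w + b w} ->
  luxemburg_le s a -> luxemburg_le t b -> luxemburg_le (s + t) c.
Proof.
move=> s0 t0 a0 b0 c0 ma mb mc cab la lb.
have st0 : 0 < s + t by rewrite addr_gt0.
have ks : (0 <= (s / (s + t))%:E)%E by rewrite lee_fin divr_ge0// ltW.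
have kt : (0 <= (t / (s + t))%:E)%E by rewrite lee_fin divr_ge0// ltW.
have Ma := measurable_phi_scaled s0 a0 ma.
have Mb := measurable_phi_scaled t0 b0 mb.
have h : (\int[P]_w (phi ((s + t)^-1 * c w))%:E <=
    (s / (s + t))%:E * \int[P]_w (phi (s^-1 * a w))%:E +
    (t / (s + t))%:E * \int[P]_w (phi (t^-1 * b w))%:E)%E.
  rewrite -!ge0_integralZl//; try by move=> w _; exact: phi_scaled_ge0.
  rewrite -ge0_integralD//; last 4 first.
  - by move=> w _; rewrite mule_ge0// phi_scaled_ge0.
  - exact: measurable_funeM.
  - by move=> w _; rewrite mule_ge0// phi_scaled_ge0.
  - exact: measurable_funeM.
  apply: ae_ge0_le_integral => //.
  - by move=> w _; exact: phi_scaled_ge0.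
  - exact: measurable_phi_scaled.
  - by move=> w _; rewrite adde_ge0// mule_ge0// phi_scaled_ge0.
  - by apply: emeasurable_funD; exact: measurable_funeM.
  apply: filterS cab => w cw _; rewrite -!EFinM -EFinD lee_fin.
  apply: le_trans (convex_add_le cphi s0 t0 (a0 w) (b0 w)).
  apply: (scale_le sphi); first by rewrite mulr_ge0// invr_ge0 ltW.
  by rewrite ler_pM2l// invr_gt0.
apply: le_trans h _.
apply: (@le_trans _ _ ((s / (s + t))%:E * 1 + (t / (s + t))%:E * 1)%E).
  by apply: leeD; apply: lee_wpmul2l.
by rewrite !mule1 -EFinD -mulrDl divff// gt_eqF.
Qed.

Lemma luxemburg_pointwise t a : 0 < t -> (forall w, 0 <= a w) ->
  measurable_fun setT a -> (forall w, phi (t^-1 * a w) <= 1) ->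
  luxemburg_le t a.
Proof.
move=> t0 a0 ma h; rewrite /luxemburg_le.
apply: (@le_trans _ _ (\int[P]_w cst 1%:E w)%E).
  apply: ge0_le_integral => //.
  - by move=> w _; exact: phi_scaled_ge0.
  - exact: measurable_phi_scaled.
  - by move=> w _; rewrite lee_fin.
by rewrite integral_cst// mul1e probability_le1.
Qed.

Lemma luxemburg_le_trans s t a : 0 < s -> s <= t -> (forall w, 0 <= a w) ->
  measurable_fun setT a -> luxemburg_le s a -> luxemburg_le t a.
Proof.
move=> s0 st a0 ma; apply: le_trans; have t0 := lt_le_trans s0 st.
apply: ge0_le_integral => //.
- by move=> w _; exact: phi_scaled_ge0.
- exact: measurable_phi_scaled.
- exact: measurable_phi_scaled.
move=> w _; rewrite lee_fin; apply: (scale_le sphi).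
  by rewrite mulr_ge0// invr_ge0 ltW.
by rewrite ler_wpM2r// lef_pV2.
Qed.

(** A convex function vanishing at 0 satisfies [phi (x / C) <= phi x / C]. *)
Lemma luxemburg_of_bound s a (C : R) : 0 < s -> (forall w, 0 <= a w) ->
  measurable_fun setT a -> 1 <= C ->
  (\int[P]_w (phi (s^-1 * a w))%:E <= C%:E)%E -> luxemburg_le (C * s) a.
Proof.
move=> s0 a0 ma C1 h; have C0 : 0 < C by apply: lt_le_trans C1.
have k0 : 0 <= C^-1 by rewrite invr_ge0 ltW.
apply: (@le_trans _ _ (C^-1%:E * \int[P]_w (phi (s^-1 * a w))%:E)%E).
  rewrite -ge0_integralZl//; last 2 first.
  - exact: measurable_phi_scaled.
  - by move=> w _; exact: phi_scaled_ge0.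
  apply: ge0_le_integral => //.
  - by move=> w _; apply: phi_scaled_ge0 => //; rewrite mulr_gt0.
  - by apply: measurable_phi_scaled => //; rewrite mulr_gt0.
  - by apply: measurable_funeM; exact: measurable_phi_scaled.
  move=> w _; rewrite -EFinM lee_fin invfM -mulrA; case: (sphi) => p0 _ _.
  apply: convex_scale_le => //; first by rewrite invf_le1.
  by rewrite mulr_ge0// invr_ge0 ltW.
apply: (@le_trans _ _ (C^-1%:E * C%:E)%E).
  by apply: lee_wpmul2l => //; rewrite lee_fin.
by rewrite -EFinM mulVf// gt_eqF.
Qed.

Lemma luxemburg_cst (c : R) : 0 <= c ->
  exists2 t, 0 < t & luxemburg_le t (fun=> c).
Proof.
move=> c0; pose C := Num.max 1 (phi c).
have C1 : 1 <= C by rewrite le_max lexx.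
have C0 : 0 < C by apply: lt_le_trans C1.
exists C => //; apply: luxemburg_pointwise => // _.
have [p0 _ _] := sphi.
apply: le_trans (@convex_scale_le _ phi C^-1 c p0 cphi _ _ c0) _.
- by rewrite invr_ge0 ltW.
- by rewrite invf_le1.
by rewrite ler_pdivrMl// mulr1 le_max lexx orbT.
Qed.

Lemma luxemburg_markov t a (r M : R) : 0 < t -> (forall w, 0 <= a w) ->
  measurable_fun setT a -> 0 < M -> 0 <= r -> M <= phi (t^-1 * r) ->
  luxemburg_le t a -> (P [set w | (r <= a w)%R] <= M^-1%:E)%E.
Proof.
move=> t0 a0 ma M0 r0 Mr la; have mA := measurable_superlevel r ma.
rewrite -(mule1 (M^-1%:E)) -lee_pdivrMl ?invr_gt0// invrK.
apply: le_trans la; rewrite -(integral_cst P mA).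
apply: (@le_trans _ _
    (\int[P]_(w in [set w | (r <= a w)%R]) (phi (t^-1 * a w))%:E)%E).
  apply: ge0_le_integral => //.
  - by move=> w _; rewrite lee_fin ltW.
  - by apply: measurable_funTS; exact: measurable_phi_scaled.
  move=> w /= rw; rewrite lee_fin; apply: le_trans Mr _.
  apply: (scale_le sphi); first by rewrite mulr_ge0// invr_ge0 ltW.
  by rewrite ler_pM2l// invr_gt0.
apply: ge0_subset_integral => //.
- exact: measurable_phi_scaled.
- by move=> w _; exact: phi_scaled_ge0.
Qed.

End luxemburg.

Lemma luxemburg_law d d' (T : measurableType d) (T' : measurableType d')
    (R : realType) (P : probability T R) (Q : probability T' R) (phi : R -> R)
    (f : T -> T') (t : R) (b : T' -> R) :
  scale_function phi -> 0 < t -> measurable_fun setT f ->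
  (forall A, measurable A -> Q A = P (f @^-1` A)) ->
  (forall y, 0 <= b y) -> measurable_fun setT b ->
  luxemburg_le Q phi t b <-> luxemburg_le P phi t (fun w => b (f w)).
Proof.
move=> sphi t0 mf QP b0 mb; rewrite /luxemburg_le.
rewrite (@ge0_integral_law _ _ _ _ _ P Q f (fun y => (phi (t^-1 * b y))%:E))//.
- exact: measurable_phi_scaled.
- by move=> y; exact: phi_scaled_ge0.
Qed.

(** * Gluing along a discrete variable *)

Section gluing.
Context d1 d2 (T1 : measurableType d1) (T2 : measurableType d2) (R : realType).
Variables (P1 : probability T1 R) (P2 : probability T2 R).
Variables (f1 : T1 -> nat) (f2 : T2 -> nat).
Hypotheses (mf1 : measurable_fun setT f1) (mf2 : measurable_fun setT f2).
Hypothesis P12 : forall n, P1 (f1 @^-1` [set n]) = P2 (f2 @^-1` [set n]).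

Let m1n n : measurable (f1 @^-1` [set n]).
Proof. exact: measurable_preimage. Qed.

Let m2n n : measurable (f2 @^-1` [set n]).
Proof. exact: measurable_preimage. Qed.

Let D n := f1 @^-1` [set n] `*` f2 @^-1` [set n].

Let mD n : measurable (D n). Proof. exact: measurableX. Qed.

Let p n := fine (P1 (f1 @^-1` [set n])).

Let pE n : P1 (f1 @^-1` [set n]) = (p n)%:E.
Proof. by rewrite /p fineK// fin_num_measure. Qed.

Let pV_ge0 n : 0 <= (p n)^-1.
Proof. by rewrite invr_ge0 fine_ge0. Qed.

(* The product measure is restricted to each [D n] and rescaled there by
   [(p n)^-1], which is 0 when [p n] is. *)
Let m := mseries
  (fun n => mscale (NngNum (pV_ge0 n)) (mrestr (P1 \x P2)%E (mD n))) 0.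

Let mE A B : measurable A -> measurable B -> m (A `*` B) =
  (\sum_(0 <= n <oo) ((p n)^-1%:E * (P1 (A `&` f1 @^-1` [set n]) *
     P2 (B `&` f2 @^-1` [set n]))))%E.
Proof.
move=> mA mB; apply: eq_eseriesr => n _.
rewrite /mscale/= /mrestr -product_measure1E//; try exact: measurableI.
by rewrite setXI.
Qed.

Let m1 A : measurable A -> m (A `*` setT) = P1 A.
Proof.
move=> mA; rewrite mE// (measure_nat_partition P1 mf1 mA).
apply: eq_eseriesr => n _ /=; rewrite setTI -P12 pE.
have [p0|p0] := eqVneq (p n) 0.
  have -> : P1 (A `&` f1 @^-1` [set n]) = 0%E.
    by apply: (@subset_measure0 _ _ _ P1 _ (f1 @^-1` [set n])) => //;
      [exact: measurableI|rewrite /= pE p0].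
  by rewrite mul0e mule0.
by rewrite muleCA -EFinM mulVf// mule1.
Qed.

Let m2 A : measurable A -> m (setT `*` A) = P2 A.
Proof.
move=> mA; rewrite mE// (measure_nat_partition P2 mf2 mA).
apply: eq_eseriesr => n _ /=; rewrite setTI pE.
have [p0|p0] := eqVneq (p n) 0.
  have -> : P2 (A `&` f2 @^-1` [set n]) = 0%E.
    by apply: (@subset_measure0 _ _ _ P2 _ (f2 @^-1` [set n])) => //;
      [exact: measurableI|rewrite /= -P12 pE p0].
  by rewrite !mule0.
by rewrite muleA -EFinM mulVf// mul1e.
Qed.

(** The two spaces are made conditionally independent given the common value of
    [f1] and [f2]; for discrete variables this needs no disintegration. *)
Lemma discrete_gluing : exists P : probability (T1 * T2)%type R,
  [/\ forall A, measurable A -> P1 A = P (fst @^-1` A),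
      forall A, measurable A -> P2 A = P (snd @^-1` A) &
      {ae P, forall z, f1 z.1 = f2 z.2}].
Proof.
have m1T : m setT = 1%E by rewrite -setXTT m1// probability_setT.
have [P PE] := probability_of_measure m1T.
exists P; split => [A mA|A mA|].
- by rewrite -setXT; exact: esym (etrans (PE _) (m1 mA)).
- by rewrite -setTX; exact: esym (etrans (PE _) (m2 mA)).
exists (~` \bigcup_n D n); split.
- by apply: measurableC; exact: bigcup_measurable.
- apply: etrans (PE _) _; apply: eseries0 => n _ _.
  change (((p n)^-1)%:E * (P1 \x P2) (~` (\bigcup_k D k) `&` D n) = 0)%E.
  rewrite (_ : _ `&` D n = set0) ?measure0 ?mule0//.
  by apply/seteqP; split => // z [] zD Dz; apply: zD; exists n.
- by move=> z /= zf [n _ [/= z1 z2]]; apply: zf; rewrite z1 z2.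
Qed.

End gluing.

(** * Cutting events of the unit interval into pieces of prescribed measures *)

(** For a finite measure this amounts to having no atoms. *)
Definition divisible d (T : measurableType d) (R : realType)
    (P : {measure set T -> \bar R}) :=
  forall (A : set T) (p : nat -> R), measurable A -> (forall n, 0 <= p n) ->
    (\sum_(0 <= n <oo) (p n)%:E = P A)%E ->
    exists2 f : T -> nat, measurable_fun setT f &
      forall n, P (A `&` f @^-1` [set n]) = (p n)%:E.

Lemma nneseries_dominated_eq (R : realType) (u v : nat -> \bar R) :
  (forall n, 0 <= v n)%E -> (forall n, v n <= u n)%E ->
  (\sum_(0 <= n <oo) u n = \sum_(0 <= n <oo) v n)%E ->
  (\sum_(0 <= n <oo) v n < +oo)%E -> forall n, u n = v n.
Proof.
move=> v0 vu uv vfin n.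
have u0 k : (0 <= u k)%E by apply: le_trans (vu k).
apply/eqP; rewrite eq_le vu andbT.
move: uv vfin; rewrite (nneseriesD1 (f := u) (n := n))//.
rewrite (nneseriesD1 (f := v) (n := n))//.
set U := (\sum_(0 <= _ <oo | _) u _)%E; set V := (\sum_(0 <= _ <oo | _) v _)%E.
have V0 : (0 <= V)%E by apply: nneseries_ge0.
have VU : (V <= U)%E by apply: lee_nneseries => // k _.
move=> uv vfin.
have Vfin : V \is a fin_num.
  by rewrite ge0_fin_numE//; apply: le_lt_trans vfin; rewrite leeDr.
rewrite -(leeD2rE _ _ Vfin); apply: (@le_trans _ _ (u n + U)%E).
  by rewrite leeD2l.
by rewrite uv.
Qed.

Section unit_interval.
Context {R : realType}.
Variable P : probability (measurableTypeR R) R.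
Hypothesis PE : forall A, P A = lebesgue_measure (A `&` `[0, 1]).

Let P_itv (x y : R) : x <= y -> (P `]x, y]%classic <= (y - x)%:E)%E.
Proof.
move=> xy; rewrite PE.
apply: (@le_trans _ _
    (lebesgue_measure (`]x, y]%classic : set (measurableTypeR R)))).
  by apply: le_measure; rewrite ?inE//; exact: measurableI.
rewrite lebesgue_measure_itv/= lte_fin; case: ifP => // _.
by rewrite lee_fin subr_ge0.
Qed.

(** The map [x |-> P (A `&` `]-oo, x])] is continuous, so it takes every partial
    sum of [p] as a value; cutting [A] at the corresponding points gives pieces
    of the prescribed measures, and what remains of [A] is negligible. *)
Lemma unit_interval_divisible : divisible P.
Proof.
move=> A p mA p0 sp.
pose B (x : R) : set (measurableTypeR R) := `]-oo, x]%classic.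
have mB x : measurable (B x) by exact: measurable_itv.
have mAB x : measurable (A `&` B x) by exact: measurableI.
have Pfin (C : set (measurableTypeR R)) : measurable C -> P C \is a fin_num.
  by move=> mC; exact: fin_num_measure.
pose g (x : R) : R := fine (P (A `&` B x)).
have gE x : P (A `&` B x) = (g x)%:E by rewrite fineK// Pfin.
have g_itv x y : x <= y -> P (A `&` `]x, y]%classic) = (g y - g x)%:E.
  move=> xy; rewrite EFinB -!gE.
  have -> : A `&` B y = (A `&` B x) `|` (A `&` `]x, y]%classic).
    rewrite -setIUr; congr (_ `&` _).
    apply/seteqP; split => z; rewrite /B/= !in_itv/=.
      by move=> zy; case: (leP z x) => zx; [left|right; rewrite zy].
    by case=> [zx|/andP[_ //]]; exact: le_trans xy.
  have mI : measurable (A `&` `]x, y]%classic) by exact: measurableI.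
  rewrite measureU//; first by rewrite addeAC subee ?add0e ?Pfin.
  apply/seteqP; split => z // [[_ zx] [_]]; move: zx; rewrite /B/= !in_itv/=.
  by move=> zx /andP[]; rewrite ltNge zx.
have gmono x y : x <= y -> g x <= g y.
  by move=> xy; rewrite -subr_ge0 -lee_fin -g_itv.
have glip x y : x <= y -> g y - g x <= y - x.
  move=> xy; rewrite -lee_fin -g_itv//; apply: le_trans (P_itv xy).
  by apply: le_measure; rewrite ?inE//; exact: measurableI.
have gcont : continuous g.
  move=> x; apply/cvgrPdist_le => e e0; near=> y.
  have xye : `|x - y| <= e by near: y; exact: cvgr_dist_le.
  apply: le_trans xye; have [xy|/ltW yx] := leP x y.
    rewrite distrC (distrC x) !ger0_norm ?subr_ge0// ?gmono//; exact: glip.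
  by rewrite !ger0_norm ?subr_ge0// ?gmono//; exact: glip.
have g0 : g 0 = 0.
  apply/eqP; rewrite -eqe -gE; apply/eqP.
  apply: (@subset_measure0 _ _ _ P _ (B 0)) => //.
  rewrite /= PE; apply: (@subset_measure0 _ _ _ lebesgue_measure _ [set 0]) => //.
  - exact: measurableI.
  - move=> z; rewrite /B/= !in_itv/= => -[z0 /andP[z0' _]].
    by apply/eqP; rewrite eq_le z0 z0'.
  - exact: lebesgue_measure_set1.
have g1 : P A = (g 1)%:E.
  rewrite -gE !PE -setIA; congr (lebesgue_measure (_ `&` _)).
  apply/seteqP; split => z; rewrite /B/= !in_itv/=; last by case.
  by move=> /andP[z0 z1]; rewrite z0 z1.
pose F n := \sum_(0 <= i < n) p i.
have F1 n : F n <= g 1.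
  rewrite -lee_fin -g1 -sp /F -sumEFin (nneseries_split 0 n); last first.
    by move=> k _; rewrite lee_fin.
  by rewrite add0n leeDl// nneseries_ge0// => k _ _; rewrite lee_fin.
have F0 n : 0 <= F n by apply: sumr_ge0.
have FS n : F n.+1 = F n + p n by rewrite /F big_nat_recr.
have /choice[h hP] : forall c, exists x, 0 <= c <= g 1 -> 0 <= x <= 1 /\ g x = c.
  move=> c; have [c01|] := boolP (0 <= c <= g 1); last by exists 0.
  have [||x] := @IVT R g 0 1 c ler01.
  - exact: continuous_subspaceT.
  - by rewrite minEle maxEle (gmono 0 1 ler01) g0.
  by rewrite in_itv/= => x01 gx; exists x.
pose x n := h (F n).
have gx n : g (x n) = F n by have [|//] := hP (F n); rewrite F0 F1.
(* When [p n = 0] the cut points [x n] and [x n.+1] coincide because the choice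
   function [h] has been fixed beforehand. *)
have xS n : x n <= x n.+1.
  rewrite leNgt; apply/negP => xlt; have := gmono _ _ (ltW xlt).
  rewrite !gx FS => h1; have pn : p n = 0.
    by apply/eqP; rewrite eq_le p0 andbT; move: h1; rewrite gerDl.
  by move: xlt; rewrite /x FS pn addr0 ltxx.
have xmono : {homo x : m n / (m <= n)%N >-> m <= n}.
  exact: homo_leq le_trans xS.
have [f [mf f1 f2]] := measurable_first_index (fun n => mB (x n.+1)).
exists f => //.
have mAf n : measurable (A `&` f @^-1` [set n]).
  by apply: measurableI => //; exact: measurable_preimage.
have pP n : ((p n)%:E <= P (A `&` f @^-1` [set n]))%E.
  rewrite (_ : p n = g (x n.+1) - g (x n)); last by rewrite !gx FS addrC addKr.
  rewrite -g_itv//; apply: le_measure; rewrite ?inE//; first exact: measurableI.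
  move=> z [Az]; rewrite /= in_itv/= => /andP[xz zx]; split => //=.
  have Bn : B (x n.+1) z by rewrite /B/= in_itv.
  apply/eqP; rewrite eqn_leq f2// leqNgt; apply/negP => fn.
  have : B (x (f z).+1) z by apply: f1; exists n.
  rewrite /B/= in_itv/= => zf.
  have := lt_le_trans xz zf; rewrite ltNge => /negP; apply; exact: xmono.
apply: nneseries_dominated_eq => //.
- by rewrite sp; exact: esym (measure_nat_partition P mf mA).
- by rewrite sp ltey_eq Pfin.
Unshelve. all: by end_near. Qed.

End unit_interval.

Lemma divisible_probability_exists (R : realType) :
  exists P : probability (measurableTypeR R) R, divisible P.
Proof.
have mI : measurable (`[0, 1]%classic : set (measurableTypeR R)).
  exact: measurable_itv.
pose m : {measure set (measurableTypeR R) -> \bar R} := mrestr lebesgue_measure mI.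
have m1 : m setT = 1%E.
  by rewrite /m/= /mrestr setTI lebesgue_measure_itv/= lte_fin ltr01 sube0.
have [P PE] := probability_of_measure m1.
by exists P; apply: unit_interval_divisible.
Qed.

(** * Realising a chain of discrete couplings on one probability space *)

Section transfer.
Context d d' (T : measurableType d) (Z : measurableType d') (R : realType).
Variables (P : probability T R) (q : probability Z R).

Lemma joint_law_eq (S S' : T -> nat) (f g : Z -> nat) (E : set (nat * nat)) :
  measurable_fun setT S -> measurable_fun setT S' ->
  measurable_fun setT f -> measurable_fun setT g ->
  (forall i j, P (S @^-1` [set i] `&` S' @^-1` [set j]) =
               q (f @^-1` [set i] `&` g @^-1` [set j])) ->
  P ((fun w => (S w, S' w)) @^-1` E) = q ((fun z => (f z, g z)) @^-1` E).
Proof.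
move=> mS mS' mf mg h.
have mP : measurable ((fun w => (S w, S' w)) @^-1` E).
  by apply: measurable_preimage (measurable_nat_nat E); exact: measurable_fun_pair.
have mq : measurable ((fun z => (f z, g z)) @^-1` E).
  by apply: measurable_preimage (measurable_nat_nat E); exact: measurable_fun_pair.
apply: etrans (measure_nat_partition P mS mP) _.
apply: etrans _ (esym (measure_nat_partition q mf mq)).
apply: eq_eseriesr => i _.
have mPi : measurable ((fun w => (S w, S' w)) @^-1` E `&` S @^-1` [set i]).
  by apply: measurableI => //; exact: measurable_preimage.
have mqi : measurable ((fun z => (f z, g z)) @^-1` E `&` f @^-1` [set i]).
  by apply: measurableI => //; exact: measurable_preimage.
apply: etrans (measure_nat_partition P mS' mPi) _.
apply: etrans _ (esym (measure_nat_partition q mg mqi)).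
apply: eq_eseriesr => j _.
have [Eij|nEij] := pselect (E (i, j)).
  rewrite (_ : _ `&` S' @^-1` _ = S @^-1` [set i] `&` S' @^-1` [set j]).
    rewrite (_ : _ `&` g @^-1` _ = f @^-1` [set i] `&` g @^-1` [set j]).
      exact: h.
    by apply/seteqP; split => z /= [] => [[_ ->] ->//|-> ->].
  by apply/seteqP; split => z /= [] => [[_ ->] ->//|-> ->].
rewrite (_ : _ `&` S' @^-1` _ = set0).
  rewrite (_ : _ `&` g @^-1` _ = set0) ?measure0//.
  by apply/seteqP; split => z //= [[+ fi] gj]; rewrite fi gj.
by apply/seteqP; split => z //= [[+ fi] gj]; rewrite fi gj.
Qed.

(** Each event [S @^-1` [set i]] is cut according to the joint law of [f] and
    [g]. *)
Lemma chain_step (f g : Z -> nat) (S : T -> nat) : divisible P ->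
  measurable_fun setT S -> measurable_fun setT f -> measurable_fun setT g ->
  (forall i, P (S @^-1` [set i]) = q (f @^-1` [set i])) ->
  exists2 S' : T -> nat, measurable_fun setT S' &
    forall i j, P (S @^-1` [set i] `&` S' @^-1` [set j]) =
                q (f @^-1` [set i] `&` g @^-1` [set j]).
Proof.
move=> dP mS mf mg h.
have mSi i : measurable (S @^-1` [set i]) by exact: measurable_preimage.
have mfi i : measurable (f @^-1` [set i]) by exact: measurable_preimage.
have mfg i j : measurable (f @^-1` [set i] `&` g @^-1` [set j]).
  by apply: measurableI => //; exact: measurable_preimage.
have qfin i j : (fine (q (f @^-1` [set i] `&` g @^-1` [set j])))%:E =
    q (f @^-1` [set i] `&` g @^-1` [set j]).
  by rewrite fineK// fin_num_measure.
have /choice[F hF] : forall i, exists s : T -> nat, measurable_fun setT s /\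
    forall j, P (S @^-1` [set i] `&` s @^-1` [set j]) =
                q (f @^-1` [set i] `&` g @^-1` [set j]).
  move=> i; have [|||s ms hs] := dP (S @^-1` [set i])
    (fun j => fine (q (f @^-1` [set i] `&` g @^-1` [set j]))).
  - exact: mSi.
  - by move=> j; exact: fine_ge0.
  - apply: etrans _ (esym (h i)).
    apply: etrans _ (esym (measure_nat_partition q mg (mfi i))).
    by apply: eq_eseriesr => j _; exact: qfin.
  by exists s; split => // j; rewrite hs qfin.
exists (fun w => F (S w) w).
  apply: measurable_fun_nat => j.
  have -> : (fun w => F (S w) w) @^-1` [set j] =
      \bigcup_i (S @^-1` [set i] `&` F i @^-1` [set j]).
    apply/seteqP; split => [w /= Fw|w [i _ [/= -> //]]].
    by exists (S w).
  apply: bigcupT_measurable => i; apply: measurableI => //.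
  by apply: measurable_preimage => //; have [] := hF i.
move=> i j; have [_ <-] := hF i; congr (P _).
by apply/seteqP; split => w /= [-> <-].
Qed.

End transfer.

Lemma chain_exists d d' (T : measurableType d) (Z : measurableType d')
    (R : realType) (P : probability T R) (q : nat -> probability Z R)
    (f g : nat -> Z -> nat) : divisible P ->
  (forall k, measurable_fun setT (f k)) -> (forall k, measurable_fun setT (g k)) ->
  (forall k i, q k (g k @^-1` [set i]) = q k.+1 (f k.+1 @^-1` [set i])) ->
  exists S : nat -> T -> nat, (forall k, measurable_fun setT (S k)) /\
    forall k i j, P (S k @^-1` [set i] `&` S k.+1 @^-1` [set j]) =
                  q k (f k @^-1` [set i] `&` g k @^-1` [set j]).
Proof.
move=> dP mf mg qq.
pose inv k (S : T -> nat) := measurable_fun setT S /\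
  forall i, P (S @^-1` [set i]) = q k (f k @^-1` [set i]).
pose jnt k (S S' : T -> nat) := forall i j,
  P (S @^-1` [set i] `&` S' @^-1` [set j]) =
  q k (f k @^-1` [set i] `&` g k @^-1` [set j]).
have /choice[nxt hnxt] : forall kS : nat * (T -> nat), exists S',
    inv kS.1 kS.2 -> inv kS.1.+1 S' /\ jnt kS.1 kS.2 S'.
  move=> [k S] /=; have [[mS hS]|] := pselect (inv k S); last by exists S.
  have [S' mS' hS'] := chain_step dP mS (mf k) (mg k) hS.
  exists S' => _; split => //; split => // j.
  have mj : measurable (S' @^-1` [set j]) by exact: measurable_preimage.
  have mgj : measurable (g k @^-1` [set j]) by exact: measurable_preimage.
  rewrite -qq; apply: etrans (measure_nat_partition P mS mj) _.
  apply: etrans _ (esym (measure_nat_partition (q k) (mf k) mgj)).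
  by apply: eq_eseriesr => i _; rewrite setIC [in RHS]setIC; exact: hS'.
have mf0 n : measurable (f 0%N @^-1` [set n]) by exact: measurable_preimage.
have [S0 mS0 hS0] : exists2 S0 : T -> nat, measurable_fun setT S0 &
    forall n, P (setT `&` S0 @^-1` [set n]) =
    (fine (q 0%N (f 0%N @^-1` [set n])))%:E.
  apply: dP => //; first by move=> n; exact: fine_ge0.
  apply: etrans _ (esym (probability_setT P)).
  apply: etrans _ (probability_setT (q 0%N)).
  apply: etrans _ (esym (measure_nat_partition (q 0%N) (mf 0%N) measurableT)).
  by apply: eq_eseriesr => i _; rewrite setTI fineK// fin_num_measure.
pose S := fix S k := if k is k'.+1 then nxt (k', S k') else S0.
have invS k : inv k (S k).
  elim: k => [|k IH]; last by have [] := hnxt (k, S k) IH.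
  by split => // i; have := hS0 i; rewrite setTI fineK// fin_num_measure.
exists S; split => [k|k]; first by have [] := invS k.
by have [_] := hnxt (k, S k) (invS k).
Qed.

(** * Almost sure limits *)

Definition dyadic (R : realType) (k : nat) : R := (2 ^ k)%:R^-1.

Section dyadic.
Context {R : realType}.
Local Notation dy := (dyadic R).

Lemma dyadic_gt0 k : 0 < dy k.
Proof. by rewrite invr_gt0 ltr0n expn_gt0. Qed.

Lemma dyadicS k : dy k = dy k.+1 + dy k.+1.
Proof.
rewrite /dyadic expnS natrM invfM; set x := _^-1; rewrite -[LHS]mul1r -mulrDl.
by congr (_ * _); rewrite [LHS]splitr div1r.
Qed.

Lemma dyadic_le m n : (m <= n)%N -> dy n <= dy m.
Proof.
by move=> mn; rewrite lef_pV2 ?posrE ?ltr0n ?expn_gt0// ler_nat leq_exp2l.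
Qed.

Lemma dyadic_lt (e : R) : 0 < e -> exists n, forall k, (n <= k)%N -> dy k < e.
Proof.
move=> e0; have [n _ /(_ n (leqnn n))/= ne] := near_infty_natSinv_lt (PosNum e0).
exists n => k nk; apply: le_lt_trans (dyadic_le nk) _; apply: le_lt_trans ne.
by rewrite lef_pV2 ?posrE ?ltr0n ?expn_gt0// ler_nat ltn_expl.
Qed.

End dyadic.

Section metric_limits.
Context {R : realType} {X : completeMetricType R}.
Local Notation dy := (dyadic R).

Lemma dyadic_cauchy_cvg (y : nat -> X) :
  (exists n, forall k, (n <= k)%N -> mdist (y k) (y k.+1) < dy k) ->
  exists l, mdist (y k) l @[k --> \oo] --> (0 : R).
Proof.
move=> [n0 hy].
have hd n j : (n0 <= n)%N -> mdist (y n) (y (n + j)%N) <=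
    dy n + dy n - (dy (n + j)%N + dy (n + j)%N).
  move=> nn; elim: j => [|j IH]; first by rewrite addn0 mdistxx subrr.
  apply: le_trans (metric_triangle _ (y (n + j)%N) _) _.
  have hj : mdist (y (n + j)%N) (y (n + j).+1) < dy (n + j)%N.
    by apply: hy; rewrite (leq_trans nn)// leq_addr.
  rewrite addnS; apply: le_trans (lerD IH (ltW hj)) _.
  by have := dyadicS (R := R) (n + j)%N; lra.
have : cauchy (y k @[k --> \oo]).
  apply/cauchyP => e e0; have e20 : 0 < e / 2 by rewrite divr_gt0.
  have [n1 hn1] := dyadic_lt e20.
  pose N := maxn n0 n1; exists (y N).
  exists N => // k /= Nk; rewrite ballEmdist /= -(subnKC Nk).
  apply: le_lt_trans (hd _ _ (leq_maxl _ _)) _.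
  by have := hn1 N (leq_maxr _ _); have := @dyadic_gt0 R (N + (k - N))%N; lra.
move=> /cauchy_cvg /cvg_ex[l yl]; exists l.
apply/cvgrPdist_lt => e e0.
have /cvg_ballP/(_ e e0) := yl; apply: filterS => k.
by rewrite ballEmdist/= sub0r normrN ger0_norm ?mdist_ge0// metric_sym.
Qed.

Lemma mdist_cvg (y : nat -> X) (x l : X) :
  mdist (y k) l @[k --> \oo] --> (0 : R) ->
  mdist x (y k) @[k --> \oo] --> mdist x l.
Proof.
move=> /cvgrPdist_le h; apply/cvgrPdist_le => e e0; near=> k.
have : mdist (y k) l <= e.
  have : `|0 - mdist (y k) l| <= e by near: k; exact: h.
  by rewrite sub0r normrN ger0_norm ?mdist_ge0.
apply: le_trans; rewrite ler_norml; apply/andP; split.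
  by have := metric_triangle x l (y k); rewrite (metric_sym l); lra.
by have := metric_triangle x (y k) l; lra.
Unshelve. all: by end_near. Qed.

(** On the exceptional null set the indices are replaced by 0, so that the
    sequence converges everywhere and its limit is measurable. *)
Lemma ae_limit d (T : measurableType d) (P : {measure set T -> \bar R})
    (a : nat -> X) (S : nat -> T -> nat) : dense_seq a ->
  (forall k, measurable_fun setT (S k)) ->
  {ae P, forall w, exists n, forall k, (n <= k)%N ->
     mdist (a (S k w)) (a (S k.+1 w)) < dy k} ->
  exists Y : T -> borelType X, measurable_fun setT Y /\
    {ae P, forall w, mdist (a (S k w)) (Y w : X) @[k --> \oo] --> (0 : R)}.
Proof.
move=> da mS [N [mN PN hN]].
have hN' w : ~ N w -> exists n, forall k, (n <= k)%N ->
     mdist (a (S k w)) (a (S k.+1 w)) < dy k.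
  by move=> nN; apply: contrapT => h; apply: nN; exact: hN.
pose S' k w := if `[< N w >] then 0%N else S k w.
have mS' k : measurable_fun setT (S' k).
  apply: measurable_fun_nat => n.
  have -> : S' k @^-1` [set n] = (S k @^-1` [set n] `&` ~` N) `|`
      (if n == 0%N then N else set0).
    apply/seteqP; split => w; rewrite /S' /=.
      case: asboolP => [Nw <-|Nw Sw]; first by right.
      by left.
    by case: asboolP => Nw; case=> [[]//|]; case: eqP => // ->.
  apply: measurableU; last by case: ifP.
  by apply: measurableI; [exact: measurable_preimage|exact: measurableC].
have /choice[Y hY] : forall w, exists l : X,
    mdist (a (S' k w)) l @[k --> \oo] --> (0 : R).
  move=> w; apply: dyadic_cauchy_cvg; rewrite /S'; case: asboolP => Nw.
    by exists 0%N => k _; rewrite mdistxx dyadic_gt0.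
  exact: hN'.
exists Y; split.
  apply: (measurable_to_metric da) => i.
  apply: (measurable_fun_cvg (h := fun k w => mdist (a i) (a (S' k w)))).
    by move=> k; apply: (measurableT_comp (f := fun n : nat => mdist (a i) (a n))).
  by move=> w _; exact: mdist_cvg.
exists N; split => // w /= nY; apply: contrapT => nN; apply: nY.
by have := hY w; rewrite /S'; case: asboolP.
Qed.

End metric_limits.

Lemma ge0_integral_ae_limit_le d (T : measurableType d) (R : realType)
    (P : {measure set T -> \bar R}) (h : nat -> T -> \bar R) (g : T -> \bar R)
    (c : \bar R) :
  (forall m, measurable_fun setT (h m)) -> measurable_fun setT g ->
  (forall m w, 0 <= h m w)%E -> (forall w, 0 <= g w)%E ->
  {ae P, forall w, h m w @[m --> \oo] --> g w} ->
  (forall m, \int[P]_w h m w <= c)%E -> (\int[P]_w g w <= c)%E.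
Proof.
move=> mh mg h0 g0 hg hc.
have mlim : measurable_fun setT (fun w => limn_einf (h ^~ w)).
  rewrite (_ : (fun w => _) =
      fun w => (- limn_esup ((fun m w => - h m w) ^~ w))%E).
    apply: measurableT_comp => //; apply: measurable_fun_limn_esup => m.
    exact: measurableT_comp.
  apply/funext => w; rewrite -limn_einfN; congr limn_einf.
  by apply/funext => m /=; rewrite oppeK.
have lim0 w : (0 <= limn_einf (h ^~ w))%E.
  rewrite limn_einf_lim; apply: lime_ge; first exact: is_cvg_einfs.
  by apply: nearW => m; apply: le_ereal_inf_tmp => _ [k _ <-].
apply: (@le_trans _ _ (\int[P]_w limn_einf (h ^~ w))%E).
  apply: ae_ge0_le_integral => //.
  by apply: filterS hg => w hw _; rewrite (cvg_limn_einf_sup hw).1.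
apply: le_trans; first exact: fatou.
rewrite limn_einf_lim; apply: lime_le; first exact: is_cvg_einfs.
apply: nearW => m; apply: le_trans (hc m); apply: ereal_inf_lbound.
by exists m => /=.
Qed.

(** * Couplings with small cost *)

Section wasserstein_distance.
Context {R : realType} {X : completeMetricType R}.
Variables (phi psi : R -> R) (a : nat -> X).
Hypotheses (sphi : scale_function phi) (cphi : convex_on_Rplus phi).
Hypotheses (spsi : scale_function psi) (cpsi : concave_on_Rplus psi).
Hypothesis da : dense_seq a.
Implicit Types (mu nu : probability (borelType X) R) (s t : R).

Local Notation BX := (borelType X).
Local Notation W := (wasserstein_dist X phi psi).
Local Notation S := (wasserstein_space X phi psi).
Local Notation dy := (dyadic R).

Definition rho (x y : X) : R := psi (mdist x y).

Definition coupled_within t mu nu := exists2 q, couplings mu nu q &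
  luxemburg_le q phi t (fun z : BX * BX => rho z.1 z.2).

Lemma rho_ge0 x y : 0 <= rho x y.
Proof. by apply: (scale_ge0 spsi); exact: mdist_ge0. Qed.

#[local] Hint Resolve rho_ge0 : core.

Lemma rho_sym x y : rho x y = rho y x.
Proof. by rewrite /rho metric_sym. Qed.

Lemma rhoxx x : rho x x = 0.
Proof. by rewrite /rho mdistxx; case: spsi. Qed.

Lemma rho_triangle y x z : rho x z <= rho x y + rho y z.
Proof.
have [p0 _ _] := spsi.
apply: le_trans (concave_subadditive p0 cpsi (mdist_ge0 _ _) (mdist_ge0 _ _)).
by apply: (scale_le spsi) (mdist_ge0 _ _) _; exact: metric_triangle.
Qed.

Lemma measurable_rho d (T : measurableType d) (f g : T -> BX) :
  measurable_fun setT f -> measurable_fun setT g ->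
  measurable_fun setT (fun w => rho (f w) (g w)).
Proof.
move=> mf mg; apply: (measurable_scale_comp spsi) => [w|].
  exact: mdist_ge0.
apply: (@measurableT_comp _ _ _ _ _ _
  (fun z : BX * BX => mdist (z.1 : X) (z.2 : X)) _ (fun w => (f w, g w))).
  exact: (measurable_mdist da).
exact: measurable_fun_pair.
Qed.

Lemma measurable_rhor d (T : measurableType d) (f : T -> BX) (y : X) :
  measurable_fun setT f -> measurable_fun setT (fun w => rho (f w) y).
Proof. by move=> mf; apply: (@measurable_rho _ _ f (fun=> y)). Qed.

Lemma coupling_fst mu nu q : couplings mu nu q ->
  forall A : set BX, measurable A -> mu A = q (fst @^-1` A).
Proof. by move=> qc A mA; rewrite -setXT; have [-> _] := qc A mA. Qed.

Lemma coupling_snd mu nu q : couplings mu nu q ->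
  forall A : set BX, measurable A -> nu A = q (snd @^-1` A).
Proof. by move=> qc A mA; rewrite -setTX; have [_ ->] := qc A mA. Qed.

Lemma coupled_within_maps d (T : measurableType d) (P : probability T R)
    (f g : T -> BX) mu nu t : 0 < t ->
  measurable_fun setT f -> measurable_fun setT g ->
  (forall A, measurable A -> mu A = P (f @^-1` A)) ->
  (forall A, measurable A -> nu A = P (g @^-1` A)) ->
  luxemburg_le P phi t (fun w => rho (f w) (g w)) -> coupled_within t mu nu.
Proof.
move=> t0 mf mg lf lg h.
have mfg : measurable_fun setT (fun w => (f w, g w)) by exact: measurable_fun_pair.
have [q qP] := law_exists P mfg.
exists q; first by move=> A mA; rewrite setXT setTX !qP lf// lg.
apply: (proj2 (luxemburg_law sphi t0 mfg (fun A _ => qP A) _ _) h) => //.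
exact: measurable_rho measurable_fst measurable_snd.
Qed.

Lemma coupled_within_sym t mu nu :
  0 < t -> coupled_within t mu nu -> coupled_within t nu mu.
Proof.
move=> t0 [q qc lq].
apply: (coupled_within_maps (P := q) (f := snd) (g := fst)) => //.
- exact: coupling_snd qc.
- exact: coupling_fst qc.
- by under eq_fun do rewrite rho_sym.
Qed.

Lemma coupled_within_refl t mu nu :
  0 < t -> measure_eq mu nu -> coupled_within t mu nu.
Proof.
move=> t0 mn; apply: (coupled_within_maps (P := mu) (f := id) (g := id)) => //.
  by move=> A mA; rewrite -mn.
apply: luxemburg_pointwise => //.
- exact: measurable_rho.
- by move=> w; rewrite rhoxx mulr0; have [-> _ _] := sphi.
Qed.

Lemma coupled_within_le s t mu nu :
  0 < s -> s <= t -> coupled_within s mu nu -> coupled_within t mu nu.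
Proof.
move=> s0 st [q qc lq]; exists q => //; apply: luxemburg_le_trans lq => //.
exact: measurable_rho measurable_fst measurable_snd.
Qed.

(** The two couplings are glued along the cell of radius [r / 2] containing the
    middle point, where [r] is so small that [psi r] has norm at most [e]. *)
Lemma coupled_within_triangle s t e mu nu la : 0 < s -> 0 < t -> 0 < e ->
  coupled_within s mu nu -> coupled_within t nu la ->
  coupled_within (s + e + t) mu la.
Proof.
move=> s0 t0 e0 [q1 q1c l1] [q2 q2c l2].
have [r r0 hr] := cost_small sphi cphi spsi e0.
have r20 : 0 < r / 2 by rewrite divr_gt0.
have [K [mK Kr]] := measurable_index da r20.
have mKn n : measurable (K @^-1` [set n]) by exact: measurable_preimage.
have [|P [P1 P2 PK]] := @discrete_gluing _ _ _ _ _ q1 q2 _ _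
    (measurableT_comp mK measurable_snd) (measurableT_comp mK measurable_fst).
  move=> n.
  exact: etrans (esym (coupling_snd q1c (mKn n))) (coupling_fst q2c (mKn n)).
pose T := ((BX * BX) * (BX * BX))%type.
have m11 : measurable_fun setT (fun w : T => w.1.1).
  exact: (measurableT_comp measurable_fst measurable_fst).
have m12 : measurable_fun setT (fun w : T => w.1.2).
  exact: (measurableT_comp measurable_snd measurable_fst).
have m21 : measurable_fun setT (fun w : T => w.2.1).
  exact: (measurableT_comp measurable_fst measurable_snd).
have m22 : measurable_fun setT (fun w : T => w.2.2).
  exact: (measurableT_comp measurable_snd measurable_snd).
have M := measurable_rho measurable_fst measurable_snd.
have L1 : luxemburg_le P phi s (fun w : T => rho w.1.1 w.1.2).
  exact: (proj1 (luxemburg_law sphi s0 measurable_fst P1 _ M) l1).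
have L2 : luxemburg_le P phi t (fun w : T => rho w.2.1 w.2.2).
  exact: (proj1 (luxemburg_law sphi t0 measurable_snd P2 _ M) l2).
have psir0 : 0 <= psi r by rewrite (scale_ge0 spsi)// ltW.
have Lr : luxemburg_le P phi e (fun _ : T => psi r).
  by apply: luxemburg_pointwise => // _; apply: hr => //; exact: ltW.
have se0 : 0 < s + e by rewrite addr_gt0.
have L1r : luxemburg_le P phi (s + e) (fun w : T => rho w.1.1 w.1.2 + psi r).
  apply: (luxemburg_add sphi cphi s0 e0 _ _ _ _ _ _ _ L1 Lr) => //.
  - by move=> w; rewrite addr_ge0.
  - exact: measurable_rho.
  - by apply: measurable_funD => //; exact: measurable_rho.
  - exact: aeW.
apply: (coupled_within_maps (P := P) (f := fun w : T => w.1.1)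
    (g := fun w : T => w.2.2)) => //.
- by rewrite addr_gt0.
- move=> A mA; rewrite (coupling_fst q1c)// P1//.
  exact: (measurable_preimage measurable_fst).
- move=> A mA; rewrite (coupling_snd q2c)// P2//.
  exact: (measurable_preimage measurable_snd).
apply: (luxemburg_add sphi cphi se0 t0 _ _ _ _ _ _ _ L1r L2) => //.
- by move=> w; rewrite addr_ge0.
- by apply: measurable_funD => //; exact: measurable_rho.
- exact: measurable_rho.
- exact: measurable_rho.
apply: filterS PK => w /= Kw.
apply: le_trans (rho_triangle w.2.1 _ _) _; rewrite lerD2r.
apply: le_trans (rho_triangle w.1.2 _ _) _; rewrite lerD2l.
apply: (scale_le spsi); first exact: mdist_ge0.
apply: le_trans (metric_triangle _ (a (K w.1.2)) _) _.
rewrite [r]splitr lerD//; first exact: ltW (Kr _).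
by rewrite metric_sym Kw; exact: ltW (Kr _).
Qed.

Lemma wasserstein_le t mu nu :
  0 < t -> coupled_within t mu nu -> (W mu nu <= t%:E)%E.
Proof.
move=> t0 [q qc lq]; apply: ereal_inf_lbound; exists t => //; split => //.
by apply: le_trans lq; apply: ereal_inf_lbound; exists q.
Qed.

(** A scale [s < t] is admissible, so some coupling has cost less than
    [t / s > 1] at scale [s], hence cost at most 1 at scale [t]. *)
Lemma wasserstein_lt_coupled t mu nu :
  (W mu nu < t%:E)%E -> coupled_within t mu nu.
Proof.
move=> /ereal_inf_lt[_ [s [s0 h] <-]]; rewrite lte_fin => st.
have C1 : 1 < t / s by rewrite ltr_pdivlMr// mul1r.
have /ereal_inf_lt[_ [q qc <-] lq] :
  (ereal_inf [set \int[q]_z (phi (s^-1 * psi (mdist (z.1 : X) (z.2 : X))))%:E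
         | q in couplings mu nu] < (t / s)%:E)%E.
  by apply: le_lt_trans h _; rewrite lte_fin.
exists q => //; rewrite -(divfK (lt0r_neq0 s0) t).
apply: luxemburg_of_bound => //.
- exact: measurable_rho measurable_fst measurable_snd.
- exact: ltW.
- exact: ltW.
Qed.

Lemma wasserstein_ge0 mu nu : (0 <= W mu nu)%E.
Proof.
by apply: le_ereal_inf_tmp => _ [t [t0 _] <-]; rewrite lee_fin ltW.
Qed.

(** Enlarging the scale makes a finite integral at most 1. *)
Lemma wasserstein_spaceP mu : S mu <-> exists (y : X) t, 0 < t /\
  luxemburg_le mu phi t (fun x : BX => rho x y).
Proof.
split=> [[y [t [t0 h]]]|[y [t [t0 h]]]]; exists y; last first.
  by exists t; split => //; apply: le_lt_trans h _; exact: ltry.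
have m0 : (0 <= \int[mu]_x (phi (t^-1 * psi (mdist (x : X) y)))%:E)%E.
  apply: integral_ge0 => x _; apply: (phi_scaled_ge0 sphi) => //.
  exact: (rho_ge0 x y).
set I := (\int[mu]_x _)%E in h m0.
have IE : I = (fine I)%:E by rewrite fineK// ge0_fin_numE.
pose C := Num.max 1 (fine I); have C1 : 1 <= C by rewrite le_max lexx.
exists (C * t); split; first by rewrite mulr_gt0// (lt_le_trans _ C1).
apply: luxemburg_of_bound => //; first exact: measurable_rhor.
by rewrite -/I IE lee_fin /C le_max lexx orbT.
Qed.

Lemma wasserstein_space_coupled t mu nu :
  0 < t -> S mu -> coupled_within t mu nu -> S nu.
Proof.
move=> t0 /wasserstein_spaceP[y [s [s0 h]]] [q qc lq]; apply/wasserstein_spaceP.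
exists y, (t + s); have ts0 : 0 < t + s by rewrite addr_gt0.
split=> //; have M : measurable_fun setT (fun x : BX => rho x y).
  exact: measurable_rhor.
have h1 : luxemburg_le q phi s (fun z => rho z.1 y).
  exact: (proj1 (luxemburg_law sphi s0 measurable_fst (coupling_fst qc) _ M)).
apply: (proj2 (luxemburg_law sphi ts0 measurable_snd (coupling_snd qc) _ M)) => //.
apply: (luxemburg_add sphi cphi t0 s0 _ _ _ _ _ _ _ lq h1) => //.
- exact: measurable_rho measurable_fst measurable_snd.
- exact: measurable_rhor measurable_fst.
- exact: measurable_rhor measurable_snd.
by apply: aeW => z; rewrite /= -(rho_sym z.2 z.1); exact: rho_triangle.
Qed.

(** Gluing along constant maps yields the independent coupling. *)
Lemma coupled_within_exists mu nu : S mu -> S nu ->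
  exists2 t, 0 < t & coupled_within t mu nu.
Proof.
move=> /wasserstein_spaceP[y [s [s0 h]]] /wasserstein_spaceP[z [t [t0 k]]].
have [|P [P1 P2 _]] := @discrete_gluing _ _ _ _ _ mu nu _ _
    (@measurable_cst _ _ _ _ setT 0%N) (@measurable_cst _ _ _ _ setT 0%N).
  by move=> n; rewrite !preimage_cst; case: ifP => _;
    rewrite ?measure0 ?probability_setT.
have [e e0 Le] := luxemburg_cst P sphi cphi (rho_ge0 y z).
have My : measurable_fun setT (fun x : BX => rho x y) by exact: measurable_rhor.
have Mz : measurable_fun setT (fun x : BX => rho x z) by exact: measurable_rhor.
have L1 : luxemburg_le P phi s (fun w => rho w.1 y).
  exact: (proj1 (luxemburg_law sphi s0 measurable_fst P1 _ My)).
have L2 : luxemburg_le P phi t (fun w => rho w.2 z).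
  exact: (proj1 (luxemburg_law sphi t0 measurable_snd P2 _ Mz)).
have se0 : 0 < s + e by rewrite addr_gt0.
have M1 : measurable_fun setT (fun w : BX * BX => rho w.1 y).
  exact: measurable_rhor.
have M2 : measurable_fun setT (fun w : BX * BX => rho w.2 z).
  exact: measurable_rhor.
have L1e : luxemburg_le P phi (s + e) (fun w => rho w.1 y + rho y z).
  apply: (luxemburg_add sphi cphi s0 e0 _ _ _ _ _ _ _ L1 Le) => //.
  - by move=> w; rewrite addr_ge0.
  - exact: measurable_funD.
  - exact: aeW.
exists (s + e + t); first by rewrite addr_gt0.
apply: (coupled_within_maps (P := P) (f := fst) (g := snd)) => //.
  by rewrite addr_gt0.
apply: (luxemburg_add sphi cphi se0 t0 _ _ _ _ _ _ _ L1e L2) => //.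
- by move=> w; rewrite addr_ge0.
- exact: measurable_funD.
- exact: measurable_rho.
apply: aeW => w; apply: le_trans (rho_triangle z _ _) _.
by rewrite (rho_sym z) lerD2r; exact: rho_triangle.
Qed.

(** * The metric axioms *)

Lemma wasserstein_lty mu nu : S mu -> S nu -> (W mu nu < +oo)%E.
Proof.
move=> Smu Snu; have [t t0 h] := coupled_within_exists Smu Snu.
exact: le_lt_trans (wasserstein_le t0 h) (ltry _).
Qed.

Lemma wasserstein_fin mu nu : S mu -> S nu -> W mu nu \is a fin_num.
Proof.
by move=> *; rewrite ge0_fin_numE ?wasserstein_ge0 ?wasserstein_lty.
Qed.

Lemma wasserstein_triangle mu nu la : S mu -> S nu -> S la ->
  (W mu la <= W mu nu + W nu la)%E.
Proof.
move=> Smu Snu Sla; apply/lee_addgt0Pr => e e0.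
have xE := esym (fineK (wasserstein_fin Smu Snu)).
have yE := esym (fineK (wasserstein_fin Snu Sla)).
set x := fine (W mu nu) in xE; set y := fine (W nu la) in yE.
have x0 : 0 <= x by apply: fine_ge0; exact: wasserstein_ge0.
have y0 : 0 <= y by apply: fine_ge0; exact: wasserstein_ge0.
have e3 : 0 < e / 3 by rewrite divr_gt0.
have h1 : coupled_within (x + e / 3) mu nu.
  by apply: wasserstein_lt_coupled; rewrite xE lte_fin ltrDl.
have h2 : coupled_within (y + e / 3) nu la.
  by apply: wasserstein_lt_coupled; rewrite yE lte_fin ltrDl.
have xe : 0 < x + e / 3 by rewrite ltr_wpDl.
have ye : 0 < y + e / 3 by rewrite ltr_wpDl.
have := wasserstein_le _ (coupled_within_triangle xe ye e3 h1 h2).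
rewrite xE yE -!EFinD.
rewrite (_ : x + e / 3 + e / 3 + (y + e / 3) = x + y + e); last by field.
by apply; rewrite ltr_wpDl// addr_ge0.
Qed.

Lemma wasserstein_sym mu nu : W mu nu = W nu mu.
Proof.
have aux m n : (W m n <= W n m)%E.
  apply: le_ereal_inf_tmp => _ [t [t0 h] <-].
  apply/lee_addgt0Pr => e e0; rewrite -EFinD.
  have te0 : 0 < t + e by rewrite addr_gt0.
  apply: wasserstein_le => //; apply: coupled_within_sym => //.
  apply: wasserstein_lt_coupled; apply: (@le_lt_trans _ _ t%:E).
    by apply: ereal_inf_lbound; exists t.
  by rewrite lte_fin ltrDl.
by apply/eqP; rewrite eq_le !aux.
Qed.

Lemma wasserstein_eq0 mu nu :
  W mu nu = 0%E <-> (forall t, 0 < t -> coupled_within t mu nu).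
Proof.
split=> [W0 t t0|h]; first by apply: wasserstein_lt_coupled; rewrite W0 lte_fin.
apply/eqP; rewrite eq_le wasserstein_ge0 andbT; apply/lee_addgt0Pr => e e0.
by rewrite add0e; exact: wasserstein_le e0 (h e e0).
Qed.

Definition thicken (F : set X) (e : R) : set X :=
  [set x | exists2 y, F y & mdist x y < e].

Lemma open_thicken F e : open (thicken F e).
Proof.
apply/open_mdist => x [y Fy xy]; exists (e - mdist x y).
  by rewrite subr_gt0.
move=> z xz; exists y => //; apply: le_lt_trans (metric_triangle _ x _) _.
by rewrite metric_sym -ltrBrDr.
Qed.

Lemma bigcap_thicken F : closed F -> \bigcap_n thicken F n.+1%:R^-1 = F.
Proof.
move=> cF; apply/seteqP; split => [x h|x Fx n _]; last first.
  by exists x => //; rewrite mdistxx invr_gt0.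
apply: contrapT => nFx.
have /open_mdist/(_ x nFx)[e e0 eF] : open (~` F) by exact: closed_openC.
have [n _ /(_ n (leqnn n))/= ne] := near_infty_natSinv_lt (PosNum e0).
have [y Fy xy] := h n I.
by apply: (eF y) => //; exact: lt_trans xy ne.
Qed.

Lemma coupled_le_thicken mu nu (F : set BX) (e : R) : 0 < e ->
  (forall t, 0 < t -> coupled_within t mu nu) ->
  measurable F -> (mu F <= nu (thicken F e))%E.
Proof.
move=> e0 h mF; apply/lee_addgt0Pr => r r0.
have psie : 0 < psi e by apply: scale_gt0.
(* at a small enough scale [s], exceeding [psi e] costs at least [r^-1] *)
have [s s0 hs] := convex_large r^-1 sphi cphi psie.
have [q qc lq] := h s s0.
have mT : measurable (thicken F e : set BX).
  by apply: borel_open; exact: open_thicken.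
pose B := [set z : BX * BX | psi e <= rho z.1 z.2].
have M := measurable_rho measurable_fst measurable_snd.
have mB : measurable B by exact: (measurable_superlevel (psi e) M).
have qB : (q B <= r%:E)%E.
  rewrite -[r]invrK; apply: (luxemburg_markov sphi s0 _ M _ _ _ lq) => //.
  - by rewrite invr_gt0.
  - exact: ltW.
  - exact: hs.
have m1 := measurable_preimage (@measurable_fst _ _ BX BX) mF.
have m2 := measurable_preimage (@measurable_snd _ _ BX BX) mT.
rewrite (coupling_fst qc mF) (coupling_snd qc mT).
apply: le_trans (leeD (lexx _) qB).
apply: le_trans (measureU2 _ m2 mB).
apply: le_measure; rewrite ?inE//; first exact: measurableU.
move=> [x y] /= Fx; have [xy|yx] := ltP (mdist x y) e.
  by left; exists x => //; rewrite metric_sym.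
by right; apply: (scale_le spsi) => //; exact: ltW.
Qed.

Lemma coupled_le_closed mu nu (F : set BX) :
  (forall t, 0 < t -> coupled_within t mu nu) ->
  closed (F : set X) -> (mu F <= nu F)%E.
Proof.
move=> h cF; pose G n := thicken F n.+1%:R^-1.
have mF : measurable F.
  rewrite -(setCK F); apply: measurableC; apply: borel_open.
  exact: closed_openC.
have mG n : measurable (G n : set BX).
  by apply: borel_open; exact: open_thicken.
have nuG : nu (G n) @[n --> \oo] --> nu F.
  rewrite -[X in nu X](bigcap_thicken cF); apply: nonincreasing_cvg_mu => //.
  - by rewrite ltey_eq fin_num_measure.
  - by rewrite bigcap_thicken.
  move=> m n mn; apply/subsetPset => x [y Fy xy]; exists y => //.
  by apply: lt_le_trans xy _; rewrite lef_pV2 ?posrE// ler_nat.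
rewrite -(cvg_lim _ nuG)//; apply: lime_ge; first by apply/cvg_ex; exists (nu F).
by apply: nearW => n; apply: coupled_le_thicken; rewrite ?invr_gt0.
Qed.

Lemma coupled_measure_eq mu nu :
  (forall t, 0 < t -> coupled_within t mu nu) -> measure_eq mu nu.
Proof.
move=> h.
have h' t : 0 < t -> coupled_within t nu mu.
  by move=> t0; exact: coupled_within_sym (h t t0).
have oeq (U : set X) : open U -> mu (U : set BX) = nu (U : set BX).
  move=> oU; have cU : closed (~` U) by exact: open_closedC.
  have mU : measurable (U : set BX) by exact: borel_open.
  have E : mu (~` U) = nu (~` U).
    by apply/eqP; rewrite eq_le !coupled_le_closed.
  have aux (m : probability BX R) : m U = (1 - m (~` U))%E.
    by rewrite -probability_setC ?setCK//; exact: measurableC.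
  by rewrite !aux E.
move=> A mA.
apply: (@measure_unique _ R BX (@open X) (fun=> setT)) => //.
- by move=> U V; exact: openI.
- by move=> _; exact: openT.
- by apply/seteqP; split => // x _; exists 0%N.
- by move=> _; rewrite ltey_eq fin_num_measure.
Qed.

Lemma wasserstein_is_metric : is_metric_on_measures S W.
Proof.
split.
- by move=> mu nu Smu Snu; rewrite wasserstein_ge0 wasserstein_lty.
- move=> mu nu Smu Snu; rewrite wasserstein_eq0; split.
    exact: coupled_measure_eq.
  by move=> mn t t0; exact: coupled_within_refl.
- by move=> mu nu _ _; exact: wasserstein_sym.
- exact: wasserstein_triangle.
Qed.

(** * Completeness *)

Lemma coupled_within_discretize t (K : BX -> nat) mu nu (e : R) :
  0 < t -> measurable_fun setT K -> (forall x : X, mdist x (a (K x)) < e) ->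
  (forall x, 0 <= x -> x <= e -> phi (t^-1 * psi x) <= 1) ->
  (forall A, measurable A -> nu A = mu ((a \o K) @^-1` A)) ->
  coupled_within t mu nu.
Proof.
move=> t0 mK Ke he hnu.
have maK : measurable_fun setT (a \o K : BX -> BX).
  exact: (measurableT_comp (f := a : nat -> BX)).
apply: (coupled_within_maps (P := mu) (f := id) (g := a \o K)) => //.
apply: luxemburg_pointwise => //; first exact: measurable_rho.
by move=> w; apply: he; [exact: mdist_ge0|exact: ltW (Ke w)].
Qed.

Lemma luxemburg_discretize t (K K' : BX -> nat) (e e' : R)
    (q : probability (BX * BX)%type R) :
  0 < t -> measurable_fun setT K -> measurable_fun setT K' ->
  (forall x : X, mdist x (a (K x)) < e) ->
  (forall x : X, mdist x (a (K' x)) < e') ->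
  (forall x, 0 <= x -> x <= e -> phi (t^-1 * psi x) <= 1) ->
  (forall x, 0 <= x -> x <= e' -> phi (t^-1 * psi x) <= 1) ->
  luxemburg_le q phi t (fun z => rho z.1 z.2) ->
  luxemburg_le q phi (t + t + t) (fun z => rho (a (K z.1)) (a (K' z.2))).
Proof.
move=> t0 mK mK' Ke Ke' he he' lq.
have tt0 : 0 < t + t by rewrite addr_gt0.
have maK : measurable_fun setT (fun z : BX * BX => a (K z.1) : BX).
  apply: (measurableT_comp (f := a : nat -> BX)) => //.
  exact: measurableT_comp.
have maK' : measurable_fun setT (fun z : BX * BX => a (K' z.2) : BX).
  apply: (measurableT_comp (f := a : nat -> BX)) => //.
  exact: measurableT_comp.
have M := measurable_rho.
have L1 : luxemburg_le q phi t (fun z => rho (a (K z.1)) z.1).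
  apply: luxemburg_pointwise => //; first exact: M.
  move=> z; rewrite /rho metric_sym; apply: he; first exact: mdist_ge0.
  exact: ltW.
have L2 : luxemburg_le q phi t (fun z => rho z.2 (a (K' z.2))).
  apply: luxemburg_pointwise => //; first exact: M.
  by move=> z; apply: he'; [exact: mdist_ge0|exact: ltW].
have L12 : luxemburg_le q phi (t + t) (fun z => rho (a (K z.1)) z.2).
  apply: (luxemburg_add sphi cphi t0 t0 _ _ _ _ _ _ _ L1 lq) => //; try exact: M.
  by apply: aeW => z; exact: rho_triangle.
apply: (luxemburg_add sphi cphi tt0 t0 _ _ _ _ _ _ _ L12 L2) => //; try exact: M.
by apply: aeW => z; exact: rho_triangle.
Qed.

Lemma luxemburg_chain d (T : measurableType d) (P : probability T R)
    (Y : nat -> T -> BX) :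
  (forall k, measurable_fun setT (Y k)) ->
  (forall k, luxemburg_le P phi (dy k) (fun w => rho (Y k w) (Y k.+1 w))) ->
  forall n m, (n <= m)%N ->
    luxemburg_le P phi (dy n + dy n) (fun w => rho (Y n w) (Y m w)).
Proof.
move=> mY lY n m nm.
have dy0 := @dyadic_gt0 R.
have [->|mn] := eqVneq m n.
  apply: luxemburg_pointwise => //; first by rewrite addr_gt0.
    exact: measurable_rho.
  by move=> w; rewrite rhoxx mulr0; have [-> _ _] := sphi.
have {mn nm} -> : m = (n + (m - n).-1.+1)%N.
  by rewrite prednK ?subnKC// subn_gt0 ltn_neqAle eq_sym mn.
set j := (m - n).-1.
(* the sum of [dy i] for [n <= i < n + j.+1] *)
suff h : luxemburg_le P phi (dy n + dy n - (dy (n + j.+1)%N + dy (n + j.+1)%N))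
    (fun w => rho (Y n w) (Y (n + j.+1)%N w)) /\
    0 < dy n + dy n - (dy (n + j.+1)%N + dy (n + j.+1)%N).
  case: h => h h0; apply: luxemburg_le_trans h => //; last exact: measurable_rho.
  by rewrite gerBl addr_ge0// ltW.
elim: j => [|j [IH IH0]]; first by rewrite addn1 -dyadicS addrK.
have -> : dy n + dy n - (dy (n + j.+2)%N + dy (n + j.+2)%N) =
    (dy n + dy n - (dy (n + j.+1)%N + dy (n + j.+1)%N)) + dy (n + j.+1)%N.
  by rewrite (addnS n j.+1) -dyadicS; lra.
split; last by rewrite addr_gt0.
have lYj := lY (n + j.+1)%N; rewrite -addnS in lYj.
apply: (luxemburg_add sphi cphi IH0 (dy0 (n + j.+1)%N) _ _ _ _ _ _ _ IH lYj) => //;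
  try exact: measurable_rho.
by apply: aeW => w; exact: rho_triangle.
Qed.

(** Since [phi] is large at [psi (dy k) / r k], the Markov inequality shows that
    [mdist (Y k w) (Y k.+1 w) >= dy k] holds with probability at most
    [dy k.+1]. *)
Lemma rapid_ae_cauchy d (T : measurableType d) (P : probability T R)
    (Y : nat -> T -> BX) (r : nat -> R) :
  (forall k, 0 < r k) ->
  (forall k, (2 ^ k.+1)%:R <= phi ((r k)^-1 * psi (dy k))) ->
  (forall k, measurable_fun setT (Y k)) ->
  (forall k, luxemburg_le P phi (r k) (fun w => rho (Y k w) (Y k.+1 w))) ->
  {ae P, forall w, exists n, forall k, (n <= k)%N ->
     mdist (Y k w : X) (Y k.+1 w) < dy k}.
Proof.
move=> r0 rphi mY lY; have dy0 := @dyadic_gt0 R.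
pose C k := [set w | psi (dy k) <= rho (Y k w) (Y k.+1 w)].
have mC k : measurable (C k).
  exact: (measurable_superlevel _ (measurable_rho (mY k) (mY k.+1))).
have PC k : (P (C k) <= (dy k.+1)%:E)%E.
  apply: (luxemburg_markov sphi (r0 k) _ _ _ _ (rphi k) (lY k)) => //.
  - exact: measurable_rho.
  - by apply: (scale_ge0 spsi); exact: ltW.
exists (lim_sup_set C); split.
- apply: bigcap_measurable => // n _.
  by apply: bigcup_measurable => k _; exact: mC.
- apply: lim_sup_set_cvg0 => //.
  apply: (@le_lt_trans _ _ (\sum_(0 <= k <oo) (1 / (2 ^ k.+1)%:R)%:E)%E).
    by apply: lee_nneseries => // k _; rewrite div1r; exact: PC.
  by apply: le_lt_trans (epsilon_trick0 xpredT ler01) (ltry _).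
move=> w /= nw n _; apply: contrapT => nC; apply: nw; exists n => k nk.
rewrite ltNge; apply/negP => dk; apply: nC; exists k => //.
by apply: (scale_le spsi) => //; exact: ltW.
Qed.

(** The limit is the law of the almost sure limit [Z] of the rounded points
    [Y k]. In the bound, rounding [v k] accounts for [r k / 3], the sum of the
    costs from [Y k] to [Z] for [dy k + dy k], and the triangle inequality for
    couplings for another [dy k]. *)
Lemma rapid_limit (v : nat -> probability BX R) (r : nat -> R) :
  (forall k, 0 < r k) -> (forall k, r k <= dy k) ->
  (forall k, (2 ^ k.+1)%:R <= phi ((r k)^-1 * psi (dy k))) ->
  (forall k, coupled_within (r k / 3) (v k) (v k.+1)) ->
  exists mu, forall k, coupled_within (4 * dy k) (v k) mu.
Proof.
move=> r0 rd rphi cv.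
have dy0 := @dyadic_gt0 R.
have r30 k : 0 < r k / 3 by rewrite divr_gt0.
have /choice[q hq] : forall k, exists q, couplings (v k) (v k.+1) q /\
    luxemburg_le q phi (r k / 3) (fun z => rho z.1 z.2).
  by move=> k; have [q q1 q2] := cv k; exists q.
have qc k : couplings (v k) (v k.+1) (q k) by have [] := hq k.
have /choice[d hd] : forall k, exists d : R, 0 < d /\
    forall x, 0 <= x -> x <= d -> phi ((r k / 3)^-1 * psi x) <= 1.
  by move=> k; have [d d0 hd] := cost_small sphi cphi spsi (r30 k); exists d.
(* Points distributed as [v k] are rounded in the couplings [q k] and [q k.-1],
   so the rounding error must be cheap for both. *)
pose e k := Num.min (d k) (d k.-1).
have e0 k : 0 < e k by rewrite lt_min; case: (hd k) => ->; case: (hd k.-1) => ->.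
have he k x : 0 <= x -> x <= e k -> phi ((r k / 3)^-1 * psi x) <= 1.
  by move=> x0; rewrite le_min => /andP[xd _]; have [_] := hd k; apply.
have heS k x : 0 <= x -> x <= e k.+1 -> phi ((r k / 3)^-1 * psi x) <= 1.
  by move=> x0; rewrite le_min => /andP[_ xd]; have [_] := hd k; apply.
have /choice[K hK] := fun k => measurable_index da (e0 k).
have mK k : measurable_fun setT (K k) by have [] := hK k.
have Ke k (x : X) : mdist x (a (K k x)) < e k by have [_] := hK k.
pose f k (z : BX * BX) := K k z.1; pose g k (z : BX * BX) := K k.+1 z.2.
have mf k : measurable_fun setT (f k).
  exact: (measurableT_comp (mK k) measurable_fst).
have mg k : measurable_fun setT (g k).
  exact: (measurableT_comp (mK k.+1) measurable_snd).
have mKB k (B : set nat) : measurable (K k @^-1` B) by exact: measurable_preimage.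
have qf k (B : set nat) : q k (f k @^-1` B) = v k (K k @^-1` B).
  by rewrite (coupling_fst (qc k)).
have qg k (B : set nat) : q k (g k @^-1` B) = v k.+1 (K k.+1 @^-1` B).
  by rewrite (coupling_snd (qc k)).
have [P dP] := divisible_probability_exists R.
have [N [mN hN]] := chain_exists dP mf mg
  (fun k i => etrans (qg k [set i]) (esym (qf k.+1 [set i]))).
pose Y k w : BX := a (N k w).
have mY k : measurable_fun setT (Y k).
  exact: (measurableT_comp (f := a : nat -> BX)).
have lY k : luxemburg_le P phi (r k) (fun w => rho (Y k w) (Y k.+1 w)).
  have mfg : measurable_fun setT (fun z => (f k z, g k z)).
    exact: measurable_fun_pair.
  have mNN : measurable_fun setT (fun w => (N k w, N k.+1 w)).
    exact: measurable_fun_pair.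
  have [Q QE] := law_exists (q k) mfg.
  have QP A : measurable A -> Q A = P ((fun w => (N k w, N k.+1 w)) @^-1` A).
    move=> _; rewrite QE; apply: esym.
    exact: (joint_law_eq A (mN k) (mN k.+1) (mf k) (mg k) (hN k)).
  pose b (ij : nat * nat) := rho (a ij.1) (a ij.2).
  have b0 ij : 0 <= b ij by exact: rho_ge0.
  have mb : measurable_fun setT b by move=> _ B _; exact: measurable_nat_nat.
  apply: (proj1 (luxemburg_law sphi (r0 k) mNN QP b0 mb)).
  apply: (proj2 (luxemburg_law sphi (r0 k) mfg (fun A _ => QE A) b0 mb)).
  have -> : r k = r k / 3 + r k / 3 + r k / 3 by lra.
  have [_ lq] := hq k.
  exact: (luxemburg_discretize (r30 k) (mK k) (mK k.+1) (Ke k) (Ke k.+1)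
    (he k) (heS k) lq).
have [Z [mZ cZ]] := ae_limit da mN (rapid_ae_cauchy r0 rphi mY lY).
have [mu muE] := law_exists P mZ.
exists mu => k.
have [w wE] := law_exists P (mY k).
have c1 : coupled_within (r k / 3) (v k) w.
  apply: (coupled_within_discretize (r30 k) (mK k) (Ke k) (he k)) => A mA.
  rewrite wE -[RHS](qf k (a @^-1` A)).
  exact: (joint_law_eq (fst @^-1` (a @^-1` A))
    (mN k) (mN k.+1) (mf k) (mg k) (hN k)).
have dd0 : 0 < dy k + dy k by rewrite addr_gt0.
have c2 : coupled_within (dy k + dy k) w mu.
  apply: (coupled_within_maps (P := P) (f := Y k) (g := Z)) => //.
  apply: (ge0_integral_ae_limit_le (h := fun m w =>
    (phi ((dy k + dy k)^-1 * rho (Y k w) (Y (k + m)%N w)))%:E)).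
  - by move=> m; apply: measurable_phi_scaled => //; exact: measurable_rho.
  - by apply: measurable_phi_scaled => //; exact: measurable_rho.
  - by move=> m x; exact: phi_scaled_ge0.
  - by move=> x; exact: phi_scaled_ge0.
  - apply: filterS cZ => x cx.
    have cx' : mdist (Y k x : X) (Y (k + m)%N x) @[m --> \oo] -->
        mdist (Y k x : X) (Z x).
      have := mdist_cvg (x := (Y k x : X)) cx; rewrite -(cvg_shiftn k).
      by under eq_fun do rewrite addnC.
    apply: cvg_EFin; first exact: nearW.
    apply: (scale_cvg sphi) => [m||].
    + by rewrite mulr_ge0// invr_ge0 ltW.
    + by rewrite mulr_ge0// invr_ge0 ltW.
    apply: cvgMr.
    by apply: (scale_cvg spsi) => // *; exact: mdist_ge0.
  - move=> m; apply: luxemburg_chain => //; last exact: leq_addr.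
    by move=> i; apply: luxemburg_le_trans (lY i) => //; exact: measurable_rho.
have := coupled_within_triangle (r30 k) dd0 (dy0 k) c1 c2.
have := dy0 k; have := r30 k; have := rd k; have := r0 k => h1 h2 h3 h4.
by apply: coupled_within_le; lra.
Qed.

Lemma radius_exists k : exists r : R,
  [/\ 0 < r, r <= dy k & (2 ^ k.+1)%:R <= phi (r^-1 * psi (dy k))].
Proof.
have psid : 0 < psi (dy k) by apply: scale_gt0 => //; exact: dyadic_gt0.
have [s s0 hs] := convex_large (2 ^ k.+1)%:R sphi cphi psid.
have m0 : 0 < Num.min s (dy k) by rewrite lt_min s0 dyadic_gt0.
exists (Num.min s (dy k)); split => //; first by rewrite ge_min lexx orbT.
by apply: hs => //; rewrite ge_min lexx.
Qed.

Lemma wasserstein_is_complete : is_complete_on S W.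
Proof.
move=> u Su cu.
have /choice[r hr] := radius_exists.
have r0 k : 0 < r k by have [] := hr k.
have rd k : r k <= dy k by have [] := hr k.
have rphi k : (2 ^ k.+1)%:R <= phi ((r k)^-1 * psi (dy k)) by have [] := hr k.
have dy0 := @dyadic_gt0 R.
have r30 k : 0 < r k / 3 by rewrite divr_gt0.
have /choice[N hN] : forall k, exists N : nat, forall m n,
    (N <= m)%N -> (N <= n)%N -> (W (u m) (u n) < (r k / 3)%:E)%E.
  move=> k; have [[A B] /= [[a' _ hA] [b' _ hB]] AB] := cu _ (r30 k).
  exists (maxn a' b') => m n; rewrite !geq_max => /andP[am _] /andP[_ bn].
  by apply: (AB (m, n)); split => /=; [exact: hA|exact: hB].
pose n k := (\sum_(i < k.+1) N i)%N.
have nN k : (N k <= n k)%N by rewrite /n big_ord_recr leq_addl.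
have nS k : (n k <= n k.+1)%N by rewrite /n [leqRHS]big_ord_recr leq_addr.
have cn k : coupled_within (r k / 3) (u (n k)) (u (n k.+1)).
  by apply: wasserstein_lt_coupled; apply: hN => //; exact: leq_trans (nS k).
have [mu hmu] := rapid_limit r0 rd rphi (v := fun k => u (n k)) cn.
have d40 : 0 < 4 * dy 0 by rewrite mulr_gt0.
have Smu : S mu := wasserstein_space_coupled d40 (Su _) (hmu 0%N).
exists mu => //.
have Wfin m : W (u m) mu \is a fin_num by exact: wasserstein_fin.
apply/fine_cvgP; split; first exact: nearW.
apply/cvgrPdist_le => e e0.
have [k hk] := dyadic_lt (divr_gt0 e0 (ltr0n R 5)).
exists (N k) => // m /= Nm.
rewrite sub0r normrN ger0_norm ?fine_ge0 ?wasserstein_ge0//.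
rewrite -lee_fin fineK//.
apply: le_trans (wasserstein_triangle (Su m) (Su (n k)) Smu) _.
apply: (@le_trans _ _ ((r k / 3)%:E + (4 * dy k)%:E)%E).
  apply: leeD; first exact: ltW (hN k _ _ Nm (nN k)).
  by apply: wasserstein_le => //; rewrite mulr_gt0.
by rewrite -EFinD lee_fin; have := hk k (leqnn k); have := rd k; have := r0 k; lra.
Qed.

End wasserstein_distance.

Theorem proposition3p2 (R : realType) (X : completeMetricType R)
    (theta phi psi : R -> R) :
  separable X ->
  ccc_function theta ->
  minimal_ccc_factorization theta phi psi ->
  is_metric_on_measures
    (wasserstein_space X phi psi) (wasserstein_dist X phi psi) /\
  is_complete_on
    (wasserstein_space X phi psi) (wasserstein_dist X phi psi).
Proof.
move=> sX _ [[sphi spsi cphi cpsi _] _].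
have [a da] := separable_dense_seq sX.
split; first exact: (wasserstein_is_metric sphi cphi spsi cpsi da).
exact: (wasserstein_is_complete sphi cphi spsi cpsi da).
Qed.
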